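(* Let $n\ge 2$ and let $z_1,\dots,z_n\in\mathbb{D}$ be distinct and nonzero. With the notation of the context, a sparse representation of the quadratic system $\hat{A}\,\hat{x}(a)=\hat{b}$ is given by $$ \begin{cases} \hat{x}=\hat{\alpha}+\hat{C}\,\hat{t}+\hat{\beta}\,t_\beta,\\ x_i = x_{\mathcal{J}_{\mathcal{I}_i}}\;\overline{x}_{\mathcal{J}_{\overline{\mathcal{I}}_i}}\,,\qquad i\in\{0,1,2,\dots,p\}\setminus\mathcal{J}, \end{cases} $$ where $\hat{t}\in\mathbb{C}^{m-1}$, $t_\beta\in\mathbb{R}$ and $\hat{x}=(x_1,\dots,x_p)^T\in\mathbb{C}^p$. A solution to this system represents a Blaschke product (or Blaschke form) $$B(z)=\frac{a_1z+\dots+a_nz^n+z^{n+1}}{1+\overline{a}_nz+\dots+\overline{a}_1z^n},$$ and the coefficients $a_i$ can be retrieved from the solution according to $a_i=x_{\mathcal{J}_i}$ for $i=1,\dots,n$.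
   Context: $\mathbb{D}$ is the open unit disk. A finite Blaschke product of degree $N$ is a function $c\prod_{j=1}^N\frac{z-\alpha_j}{1-\overline{\alpha}_jz}$ with $|c|=1$, $|\alpha_j|<1$. A Blaschke form is an irreducible rational function of the form $\frac{a_0+a_1z+\dots+a_Nz^N}{\overline a_N+\overline a_{N-1}z+\dots+\overline a_0z^N}$ having at least one pole in $\mathbb{D}$. Points: $z_{n+j}:=1/\overline{z}_j$, $j=1,\dots,n$. Put $m:=\lfloor n^2/2\rfloor$ and $p:=\lfloor n^2/2\rfloor+n$. Variable vectors: for $a=(a_1,\dots,a_n)\in\mathbb{C}^n$ let - $x^0(a)=(a_1)$, $x^1(a)=(a_2)$, $x^{2n-1}(a)=(\overline a_2)$, $x^{2n}(a)=(\overline a_1)$; - for $2\le d\le n-1$: $x^d(a)=\bigl(a_{d+1},(a_i\overline a_{n-d+i})_{i=1}^d\bigr)$, the entry $i=(d+1)/2$ being omitted if $d$ is odd; - $x^n(a)=(a_i\overline a_i)_{i=1}^n$, the entry $i=(n+1)/2$ being omitted if $n$ is odd; - for $n+1\le d\le 2n-2$: $x^d(a)=\bigl((\overline a_{2n-d+1-i}\,a_{n+1-i})_{i=1}^{2n-d},\overline a_{2n-d+1}\bigr)$, the entry $i=(2n-d+1)/2$ being omitted if $d$ is odd. $x(a)\in\mathbb{C}^{n^2+n}$ is the column vector obtained by concatenating $x^0(a),\dots,x^{2n}(a)$, and $\hat x(a)\in\mathbb{C}^p$ the one obtained by concatenating $x^0(a),\dots,x^n(a)$. Weights: $w^0=w^{2n}=(1)$,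 $w^1=w^{2n-1}=(2)$; for $2\le d\le n-1$, $w^d=\bigl(d+1,(2i-d-1)_{i=1}^d\bigr)$; $w^n=(2i-n-1)_{i=1}^n$; for $n+1\le d\le 2n-2$, $w^d=\bigl((2(n-i)-d+1)_{i=1}^{2n-d},2n-d+1\bigr)$, with exactly the same entries omitted as in $x^d(a)$. $A$ is the $2n\times(n^2+n)$ matrix whose $k$-th row is $(z_k^0w^0,z_k^1w^1,\dots,z_k^{2n}w^{2n})$. $\hat A\in\mathbb{C}^{n\times p}$ is the submatrix of $A$ consisting of rows $1$ to $n$ and columns $1$ to $p$, and $\hat b:=-(n+1)(z_1^n,\dots,z_n^n)^T$. Index vectors: $\mathcal{I}=(\mathcal{I}_1,\dots,\mathcal{I}_{n^2+n})$ and $\overline{\mathcal{I}}=(\overline{\mathcal{I}}_1,\dots,\overline{\mathcal{I}}_{n^2+n})$ are defined by: the $i$-th entry of $x(a)$ is $a_{\mathcal{I}_i}\overline a_{\overline{\mathcal{I}}_i}$, where the index $0$ is used if the unconjugated (resp. conjugated) factor is missing, with $a_0:=\overline a_0:=1$. Further $\mathcal{J}=(\mathcal{J}_0,\dots,\mathcal{J}_n)$ with $\mathcal{J}_0:=0$ and $\mathcal{J}_i:=\lceil (i-1)^2/2\rceil+1$ for $1\le i\le n$ (the position of $a_i$ in $x(a)$), and $x_0:=a_0=1$, $\overline x_0:=\overline a_0=1$. In $\{0,\dots,p\}\setminus\mathcal{J}$ the vector $\mathcal{J}$ is read as the set of its entries. Vectors $\hat\alpha,\hat\beta$: write $W_0(z)=\prod_{j=1}^n(z-z_j)(z-1/\overline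 z_j)=\sum_{j=0}^{2n}\omega_jz^j$, $c_j:=(n+1)\omega_j/\omega_n$ (here $\omega_n\neq0$ automatically) and $s_i:=c_{i-1}/i$, $i=1,\dots,n$. The vector $\alpha\in\mathbb{C}^{n^2+n}$ is obtained from $x(a)$ by replacing each linear entry $a_i$ by $s_i$, each linear entry $\overline a_i$ by $\overline{s_i}$, and each quadratic entry $a_i\overline a_j$ by $0$. The vector $\beta$ is obtained in the same way, except that each entry $a_i\overline a_i$ of the degree-$n$ block $x^n(a)$ is replaced by $y_i$, where $y_i=-\frac{3(n+1-2i)}{n(n-1)}$ for $1\le i\le\lfloor n/2\rfloor$ and $y_i=-y_{n+1-i}$ for $\lceil n/2\rceil+1\le i\le n$. $\hat\alpha,\hat\beta\in\mathbb{C}^p$ consist of the first $p$ entries of $\alpha,\beta$. Matrix $\hat C$: $0^r$ denotes a zero column of length $r$. For $2\le d\le n$ the matrix $C^d$ has the following columns $v_k^d$ in increasing order of $k$. - $d$ even, $d\le n-1$: $v_1^d=(d-1,d+1,0^{d-1})^T$, and $v_k^d=(0^{k-1},-d+2k-1,d-2k+3,0^{d-k})^T$ for $2\le k\le d$. - $d=n$ even: $v_k^n=(0^{k-2},-n+2k-1,n-2k+3,0^{n-k})^T$ for $2\le k\le n$. - $d$ odd, $3\le d\le n-1$: $v_1^d=(d-1,d+1,0^{d-2})^T$; $v_k^d=(0^{k-1},-d+2k-1,d-2k+3,0^{d-k-1})^T$ for $2\le k\le\frac{d-1}2$; $v_{(d+1)/2}^d=(0^{(d-1)/2},1,1,0^{(d-3)/2})^T$;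 $v_k^d=(0^{k-1},-d+2k+1,d-2k+1,0^{d-k-1})^T$ for $\frac{d+3}2\le k\le d-1$. - $d=n$ odd: $v_k^n=(0^{k-2},-n+2k-1,n-2k+3,0^{n-k-1})^T$ for $2\le k\le\frac{n-1}2$; $v_{(n+1)/2}^n=(0^{(n-3)/2},1,1,0^{(n-3)/2})^T$; $v_k^n=(0^{k-2},-n+2k+1,n-2k+1,0^{n-k-1})^T$ for $\frac{n+3}2\le k\le n-1$. $\hat C$ is the $p\times(m-1)$ matrix whose first two rows (degrees $0$ and $1$) are zero and whose remaining rows form the block-diagonal matrix $\mathrm{diag}(C^2,C^3,\dots,C^n)$.
   Formalization: Read literally, Âx̂(a)=b̂ (only columns 1 to p of A) is not equivalent to the sparse system (n=2, z=±1/2, a=(2+√7,0) solves only the former); the quadratic system is taken instead as rows 1 to n of A with all columns times x(a), equal to b̂. *)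

(* Defs.v *)
From HB Require Import structures.
From mathcomp Require Import all_boot all_order all_algebra.
From mathcomp Require Import reals.
From mathcomp Require Import complex.

Set Implicit Arguments.
Unset Strict Implicit.
Unset Printing Implicit Defensive.

Import Order.TTheory GRing.Theory Num.Theory.
Local Open Scope ring_scope.

(* Vectors of varying length are built as sequences, blockwise in the degree
   d = 0, ..., 2n, and only turned into matrices at the end.  The matrix entry
   with (0-based) index i is the (i+1)-st entry in the usual numbering. *)
Definition colv (C : numClosedFieldType) (N : nat) (s : seq C) : 'cV[C]_N :=
  \col_i s`_i.

Definition concat (n : nat) (T : Type) (blk : nat -> seq T) : seq T :=
  flatten [seq blk d | d <- iota 0 (2 * n).+1].

(* m = floor(n^2/2), p = m + n; moreover n^2 + n = p + q, which is the form
   that lets a vector be split into its first p and its last q entries. *)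
Definition dimm (n : nat) : nat := (n ^ 2)./2.
Definition dimp (n : nat) : nat := (dimm n + n)%N.
Definition dimq (n : nat) : nat := uphalf (n ^ 2).

Lemma dimpq n : (dimp n + dimq n = n ^ 2 + n)%N.
Proof.
by rewrite /dimp /dimq /dimm addnAC uphalf_half addnCA addnn odd_double_half.
Qed.

(* 1-based access to a vector v, extended by the convention v_0 = 1. *)
Definition ext (C : numClosedFieldType) (N : nat) (v : 'cV[C]_N) (i : nat) : C :=
  (1 :: [seq v j 0 | j <- enum 'I_N])`_i.

(* The indices i = 1, ..., l that remain when i = h/2 is omitted (which occurs
   only for h even). *)
Definition idx (l h : nat) : seq nat := [seq i <- iota 1 l | (2 * i != h)%N].

(* The block x^d(a), symbolically: the pair (i, j) stands for a_i * conj a_j,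
   the index 0 standing for a missing factor. *)
Definition xblock (n d : nat) : seq (nat * nat) :=
  if d == 0%N then [:: (1, 0)]%N
  else if d == 1%N then [:: (2, 0)]%N
  else if (d < n)%N then
    (d.+1, 0%N) :: [seq (i, (n - d + i)%N) | i <- idx d d.+1]
  else if d == n then [seq (i, i) | i <- idx n n.+1]
  else if (d <= 2 * n - 2)%N then
    rcons [seq ((n.+1 - i)%N, (2 * n - d + 1 - i)%N)
             | i <- idx (2 * n - d) (2 * n - d + 1)]
          (0%N, (2 * n - d + 1)%N)
  else if d == (2 * n - 1)%N then [:: (0, 2)]%N
  else [:: (0, 1)]%N.

Definition wblock (C : numClosedFieldType) (n d : nat) : seq C :=
  if d == 0%N then [:: 1]
  else if d == 1%N then [:: 2]
  else if (d < n)%N then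
    (d.+1)%:R :: [seq (2 * i)%:R - d%:R - 1 | i <- idx d d.+1]
  else if d == n then [seq (2 * i)%:R - n%:R - 1 | i <- idx n n.+1]
  else if (d <= 2 * n - 2)%N then
    rcons [seq (2 * (n - i))%:R - d%:R + 1
             | i <- idx (2 * n - d) (2 * n - d + 1)]
          (2 * n - d + 1)%:R
  else if d == (2 * n - 1)%N then [:: 2]
  else [:: 1].

Definition monom (C : numClosedFieldType) (n : nat) (a : 'cV[C]_n)
    (e : nat * nat) : C :=
  ext a e.1 * (ext a e.2)^*.

Definition xvec (C : numClosedFieldType) (n : nat) (a : 'cV[C]_n) :
    'cV[C]_(dimp n + dimq n) :=
  colv _ (concat n (fun d => [seq monom a e | e <- xblock n d])).

Definition xhat (C : numClosedFieldType) (n : nat) (a : 'cV[C]_n) :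
    'cV[C]_(dimp n) := usubmx (xvec a).

Definition xtail (C : numClosedFieldType) (n : nat) (a : 'cV[C]_n) :
    'cV[C]_(dimq n) := dsubmx (xvec a).

(* The two index vectors, 1-based (and with value 0 at the index 0). *)
Definition Iidx (n i : nat) : nat :=
  (nth (0, 0)%N ((0, 0)%N :: concat n (xblock n)) i).1.
Definition Ibar (n i : nat) : nat :=
  (nth (0, 0)%N ((0, 0)%N :: concat n (xblock n)) i).2.

(* uphalf k is the ceiling of k/2. *)
Definition Jidx (i : nat) : nat :=
  if i == 0%N then 0%N else (uphalf ((i - 1) ^ 2) + 1)%N.
Definition Jset (n : nat) : seq nat := [seq Jidx i | i <- iota 0 n.+1].

Definition zpt (C : numClosedFieldType) (n : nat) (z : 'I_n -> C)
    (k : 'I_(n + n)) : C :=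
  match split k with inl j => z j | inr j => ((z j)^*)^-1 end.

Definition Amx (C : numClosedFieldType) (n : nat) (z : 'I_n -> C) :
    'M[C]_(n + n, dimp n + dimq n) :=
  \matrix_(k, i)
    (concat n (fun d => [seq zpt z k ^+ d * w | w <- wblock C n d]))`_i.

Definition Ahat (C : numClosedFieldType) (n : nat) (z : 'I_n -> C) :
    'M[C]_(n, dimp n) := ulsubmx (Amx z).

Definition Atail (C : numClosedFieldType) (n : nat) (z : 'I_n -> C) :
    'M[C]_(n, dimq n) := ursubmx (Amx z).

Definition bhat (C : numClosedFieldType) (n : nat) (z : 'I_n -> C) : 'cV[C]_n :=
  \col_k (- (n.+1)%:R * z k ^+ n).

(* Row k says that the numerator of B', the self-inversive polynomial
     W(z) = sum_(d <= 2n) (w^d x^d(a)) z^d + (n+1) z^n,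
   vanishes at z_k (W then also vanishes at 1 / conj z_k).  In this row,
   Ahat *m xhat a collects the terms with d <= n, and Atail *m xtail a those
   with d > n, whose unknowns are, up to order, conjugates of entries of xhat a.
   The latter terms are part of W(z_k): the truncated system
   Ahat *m xhat a = bhat has other solutions a and is not equivalent to the
   sparse system (for n = 2 and z = (1/2, -1/2), the two have no common
   solution with a_2 = 0, but both have solutions with a_2 = 0). *)
Definition quad_system (C : numClosedFieldType) (n : nat) (z : 'I_n -> C)
    (a : 'cV[C]_n) : Prop :=
  Ahat z *m xhat a + Atail z *m xtail a = bhat z.

Definition W0 (C : numClosedFieldType) (n : nat) (z : 'I_n -> C) : {poly C} :=
  \prod_(j < n) (('X - (z j)%:P) * ('X - (((z j)^*)^-1)%:P)).

Definition ccoef (C : numClosedFieldType) (n : nat) (z : 'I_n -> C) (j : nat) : C :=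
  (n.+1)%:R * (W0 z)`_j / (W0 z)`_n.

Definition scoef (C : numClosedFieldType) (n : nat) (z : 'I_n -> C) (i : nat) : C :=
  ccoef z i.-1 / i%:R.

Definition alpha_entry (C : numClosedFieldType) (n : nat) (z : 'I_n -> C)
    (e : nat * nat) : C :=
  if e.2 == 0%N then scoef z e.1
  else if e.1 == 0%N then (scoef z e.2)^*
  else 0.

Definition ylow (C : numClosedFieldType) (n i : nat) : C :=
  - (3 * ((n.+1)%:R - (2 * i)%:R) / (n * (n - 1))%:R).
Definition ycoef (C : numClosedFieldType) (n i : nat) : C :=
  if (i <= n./2)%N then ylow C n i else - ylow C n (n.+1 - i).

Definition alphahat (C : numClosedFieldType) (n : nat) (z : 'I_n -> C) :
    'cV[C]_(dimp n) :=
  usubmx (colv (dimp n + dimq n)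
    (concat n (fun d => [seq alpha_entry z e | e <- xblock n d]))).

Definition betahat (C : numClosedFieldType) (n : nat) (z : 'I_n -> C) :
    'cV[C]_(dimp n) :=
  usubmx (colv (dimp n + dimq n)
    (concat n (fun d =>
       [seq if d == n then ycoef C n e.1 else alpha_entry z e
          | e <- xblock n d]))).

(* The column v_k^d of C^d. *)
Definition vcol (C : numClosedFieldType) (n d k : nat) : seq C :=
  let zeros r := nseq r (0 : C) in
  let D : C := d%:R in
  let K : C := k%:R in
  if (d < n)%N then
    if ~~ odd d then
      if k == 1%N then [:: D - 1; D + 1] ++ zeros (d - 1)%N
      else zeros (k - 1)%N ++ [:: - D + 2 * K - 1; D - 2 * K + 3]
             ++ zeros (d - k)%N
    else
      if k == 1%N then [:: D - 1; D + 1] ++ zeros (d - 2)%N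
      else if (k <= (d - 1)./2)%N then
        zeros (k - 1)%N ++ [:: - D + 2 * K - 1; D - 2 * K + 3]
          ++ zeros (d - k - 1)%N
      else if k == (d.+1)./2 then
        zeros (d - 1)./2 ++ [:: 1; 1] ++ zeros (d - 3)./2
      else
        zeros (k - 1)%N ++ [:: - D + 2 * K + 1; D - 2 * K + 1]
          ++ zeros (d - k - 1)%N
  else
    if ~~ odd d then
      zeros (k - 2)%N ++ [:: - D + 2 * K - 1; D - 2 * K + 3] ++ zeros (d - k)%N
    else
      if (k <= (d - 1)./2)%N then
        zeros (k - 2)%N ++ [:: - D + 2 * K - 1; D - 2 * K + 3]
          ++ zeros (d - k - 1)%N
      else if k == (d.+1)./2 then
        zeros (d - 3)./2 ++ [:: 1; 1] ++ zeros (d - 3)./2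
      else
        zeros (k - 2)%N ++ [:: - D + 2 * K + 1; D - 2 * K + 1]
          ++ zeros (d - k - 1)%N.

Definition vrange (n d : nat) : seq nat :=
  let last := if odd d then (d - 1)%N else d in
  let first := if (d < n)%N then 1%N else 2 in
  index_iota first last.+1.

(* The columns of C^d have the length of the block x^d(a), so the rows of C^d
   start below those of the blocks of lower degree. *)
Definition Chat_cols (C : numClosedFieldType) (n : nat) : seq (seq C) :=
  flatten [seq [seq nseq (\sum_(e < d) size (xblock n e))%N 0 ++ vcol C n d k
                  | k <- vrange n d]
             | d <- iota 2 n.-1].

Definition Chat (C : numClosedFieldType) (n : nat) :
    'M[C]_(dimp n, dimm n - 1) :=
  \matrix_(i, j) (nth [::] (Chat_cols C n) j)`_i.

Definition sparse_system (C : numClosedFieldType) (n : nat) (z : 'I_n -> C)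
    (x : 'cV[C]_(dimp n)) (t : 'cV[C]_(dimm n - 1)) (tbeta : C) : Prop :=
  x = alphahat z + Chat C n *m t + tbeta *: betahat z
  /\ forall i : nat, (i <= dimp n)%N -> i \notin Jset n ->
       ext x i = ext x (Jidx (Iidx n i)) * (ext x (Jidx (Ibar n i)))^*.

Definition Bnum (C : numClosedFieldType) (n : nat) (a : 'cV[C]_n) : {poly C} :=
  \sum_(1 <= i < n.+1) ext a i *: 'X^i + 'X^(n.+1).
Definition Bden (C : numClosedFieldType) (n : nat) (a : 'cV[C]_n) : {poly C} :=
  1 + \sum_(1 <= i < n.+1) (ext a i)^* *: 'X^(n.+1 - i).
Definition Bfun (C : numClosedFieldType) (n : nat) (a : 'cV[C]_n) :
    {fraction {poly C}} := tofrac (Bnum a) / tofrac (Bden a).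

Definition blaschke_product (C : numClosedFieldType) (N : nat)
    (f : {fraction {poly C}}) : Prop :=
  exists (c : C) (alpha : 'I_N -> C),
    [/\ `|c| = 1, (forall j, `|alpha j| < 1) &
        f = tofrac c%:P *
            \prod_(j < N) (tofrac ('X - (alpha j)%:P)
                           / tofrac (1 - (alpha j)^* *: 'X))].

(* Irreducibility means coprime numerator and denominator, so that the poles
   are the roots of the denominator. *)
Definition blaschke_form (C : numClosedFieldType) (N : nat)
    (f : {fraction {poly C}}) : Prop :=
  exists a : 'I_N.+1 -> C,
    let num : {poly C} := \sum_i a i *: 'X^i in
    let den : {poly C} := \sum_i (a (rev_ord i))^* *: 'X^i in
    [/\ coprimep num den, (exists2 w, `|w| < 1 & root den w) &
        f = tofrac num / tofrac den].

(* Main.v *)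
Require Import Defs.
From HB Require Import structures.
From mathcomp Require Import all_boot all_order all_algebra.
From mathcomp Require Import reals.
From mathcomp Require Import complex.
From mathcomp Require Import separable zify ring.

Set Implicit Arguments.
Unset Strict Implicit.
Unset Printing Implicit Defensive.

Import Order.TTheory GRing.Theory Num.Theory.
Local Open Scope ring_scope.

(** Write P and Q for the numerator and the denominator of B.  The numerator
    W = P' Q - P Q' of B' has degree at most 2n, and since Q is the conjugate
    reciprocal of P it is self-inversive: its coefficients satisfy
    W_{2n-d} = conj W_d ([wronskian_self_inversive]).  The quadratic system says
    that W vanishes at the n given points ([quad_systemP]).  By the symmetry W
    then vanishes at their reflections too, hence is a constant multiple of W_0.
    The middle coefficient of W_0 is, up to a nonzero constant, the sum of the
    squared moduli of the coefficients of the monic polynomial with zeros z_j, so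
    it does not vanish, and W_0 can be normalized to the self-inversive polynomial
    with coefficients c_d and c_n = n + 1.  So the system amounts to W_d = tau c_d
    for d <= n with a real number tau; the coefficients with d > n follow by
    conjugation ([self_inversive_multiple]).

    For each d this is one linear equation, w^d . x^d = given value, for the
    products of the a_i that make up the block x^d.  Its particular solutions are
    supplied by alpha and beta, with tau = 1 + t_beta, and its homogeneous
    solutions by the columns of C^d: each of them is a multiple of
    w_{j+1} e_j - w_j e_{j+1}, and these span the kernel of w^d because all
    weights are nonzero ([vcolE], [Chat_ker], [sparse_linearP]).  The remaining
    equations of the sparse system say that the entries of x really are the
    products of its linear entries, so that x = xhat a for the vector a of these
    ([quadratic_eqs_xhat], [quadratic_eqsP]).

    A solution is a Blaschke product or form because P and Q have no common zero:
    a common zero would be a double zero of W, but W is a multiple of W_0, whose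
    2n zeros are simple, and W is not 0 ([coprime_Bnum_Bden]).  Then the zeros of
    P stay off the unit circle, and either all of them lie in the disk or the
    reflection of one of them is a pole in the disk ([Bfun_blaschke]). *)

(** * Sizes and positions of the blocks *)

Lemma idxE d : idx d d.+1 =
  if odd d then iota 1 d./2 ++ iota d./2.+2 d./2 else iota 1 d.
Proof.
rewrite /idx; case: ifPn => od.
  have -> : iota 1 d = iota 1 d./2 ++ d./2.+1 :: iota d./2.+2 d./2.
    have {1}-> : d = (d./2 + d./2.+1)%N by lia.
    by rewrite iotaD add1n.
  rewrite filter_cat /=; case: eqP => [_|]; last lia.
  by congr (_ ++ _); apply/all_filterP/allP => i; rewrite mem_iota; lia.
by apply/all_filterP/allP => i _; lia.
Qed.

Lemma size_idx d : size (idx d d.+1) = (d - odd d)%N.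
Proof. by rewrite idxE; case: ifP => od; rewrite ?size_cat !size_iota; lia. Qed.

Lemma nth_idx d j : (j < d - odd d)%N ->
  nth 0%N (idx d d.+1) j = (j.+1 + (odd d && (d./2 <= j)))%N.
Proof.
rewrite idxE; case: ifP => od /= hj; last by rewrite nth_iota; lia.
by rewrite nth_cat size_iota; case: ltnP => hd; rewrite nth_iota; lia.
Qed.

Lemma mem_idx d i : i \in idx d d.+1 = (0 < i <= d)%N && ((2 * i)%N != d.+1).
Proof. by rewrite mem_filter mem_iota add1n ltnS andbC. Qed.

Lemma xblock_lt n d : (2 <= n)%N -> (d < n)%N ->
  xblock n d = (d.+1, 0%N) :: [seq (i, (n - d + i)%N) | i <- idx d d.+1].
Proof.
by move=> hn hd; rewrite /xblock; case: d hd => [|[|d]] hd //=; rewrite hd.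
Qed.

Lemma xblock_diag n : (2 <= n)%N ->
  xblock n n = [seq (i, i) | i <- idx n n.+1].
Proof. by case: n => [|[|n]] // _; rewrite /xblock /= ltnn eqxx. Qed.

Lemma xblock_gt n d : (2 <= n)%N -> (d < n)%N -> xblock n (2 * n - d) =
  rcons [seq ((n.+1 - i)%N, (d.+1 - i)%N) | i <- idx d d.+1] (0%N, d.+1).
Proof.
move=> hn hd; rewrite /xblock.
have hsub : (2 * n - (2 * n - d) = d)%N by lia.
rewrite hsub addn1.
do 4 (case: ifPn => [?|_]; first lia).
case: ifPn => [//|h]; have {h}: d = 0%N \/ d = 1%N by lia.
by case=> ->; case: ifPn => //; lia.
Qed.

Lemma size_xblock n d : (2 <= n)%N -> (d <= n)%N ->
  size (xblock n d) = (d - odd d + (d < n))%N.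
Proof.
move=> hn; rewrite leq_eqVlt => /predU1P[->|hd].
  by rewrite xblock_diag // size_map size_idx ltnn addn0.
by rewrite xblock_lt //= size_map size_idx hd addn1.
Qed.

Lemma size_xblock_gt n d : (2 <= n)%N -> (d < n)%N ->
  size (xblock n (2 * n - d)) = size (xblock n d).
Proof.
by move=> hn hd; rewrite xblock_gt // size_rcons xblock_lt //= !size_map.
Qed.

Lemma xblock_gt0 n d : (2 <= n)%N -> (d <= n)%N -> (0 < size (xblock n d))%N.
Proof. by move=> hn hd; rewrite size_xblock; lia. Qed.

Definition off (n d : nat) : nat := \sum_(e < d) size (xblock n e).

Lemma offS n d : off n d.+1 = (off n d + size (xblock n d))%N.
Proof. by rewrite /off big_ord_recr. Qed.

Lemma off_mono n : {homo off n : d e / (d <= e)%N}.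
Proof. by apply: homo_leq leqnn leq_trans _ => d; rewrite offS leq_addr. Qed.

Lemma off_le n d : (2 <= n)%N -> (d <= n)%N -> off n d = uphalf (d ^ 2).
Proof.
move=> hn; elim: d => [_|d IH hd]; first by rewrite /off big_ord0.
rewrite offS IH ?(ltnW hd) // size_xblock ?(ltnW hd) // hd.
have hodd : odd (d * d) = odd d by rewrite oddM andbb.
by rewrite -!mulnn mulSn mulnS; move: (d * d)%N hodd => e; lia.
Qed.

Lemma off_dimp n : (2 <= n)%N -> off n n.+1 = dimp n.
Proof.
move=> hn; rewrite offS off_le // size_xblock // ltnn addn0 /dimp /dimm.
have hodd : odd (n ^ 2) = odd n by rewrite oddX.
rewrite uphalf_half hodd; move: (_ ^ 2)%N => e; case: (odd n); lia.
Qed.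

(** The block of degree 2n - d mirrors that of degree d, so past the middle
    the offsets retrace the earlier sizes in reverse. *)
Lemma off_rev n k : (2 <= n)%N -> (k <= n)%N ->
  (off n (n.+1 + k) = off n n.+1 + (off n n - off n (n - k)))%N.
Proof.
move=> hn; elim: k => [_|k IH hk]; first by rewrite subn0 subnn !addn0.
rewrite addnS offS IH; last by lia.
have -> : (n.+1 + k = 2 * n - (n - k.+1))%N by lia.
rewrite size_xblock_gt; [|lia..].
have -> : (n - k = (n - k.+1).+1)%N by lia.
have : (off n (n - k.+1).+1 <= off n n)%N.
  by apply: off_mono; lia.
rewrite offS; lia.
Qed.

Lemma off_dimpq n : (2 <= n)%N -> off n (2 * n).+1 = (dimp n + dimq n)%N.
Proof.
move=> hn; have -> : ((2 * n).+1 = n.+1 + n)%N by lia.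
rewrite off_rev // off_dimp // subnn {2}/off big_ord0 subn0.
by rewrite off_le.
Qed.

Lemma off_lt n d e : (2 <= n)%N -> (d < e <= n.+1)%N -> 
  (off n d + size (xblock n d) <= off n e)%N.
Proof.
move=> hn; elim: e => // e IH; rewrite ltnS => /andP[].
rewrite leq_eqVlt => /predU1P[->|hde] he; first by rewrite offS.
by rewrite offS; apply: leq_trans (IH _) (leq_addr _ _); lia.
Qed.

Lemma pos_inj n d e i j : (2 <= n)%N -> (d <= n)%N -> (e <= n)%N ->
  (i < size (xblock n d))%N -> (j < size (xblock n e))%N ->
  ((off n d + i)%N == (off n e + j)%N) = (d == e) && (i == j).
Proof.
move=> hn hd he hi hj; case: (ltngtP d e) => [hde|hed|hde].
- have /(off_lt hn) : (d < e <= n.+1)%N by lia.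
  by move=> h; apply/negbTE; lia.
- have /(off_lt hn) : (e < d <= n.+1)%N by lia.
  by move=> h; apply/negbTE; lia.
- by rewrite hde eqn_add2l.
Qed.

Lemma posP n m i : (i < off n m)%N ->
  exists d j, [/\ (d < m)%N, (j < size (xblock n d))%N & i = (off n d + j)%N].
Proof.
elim: m => [|m IH]; first by rewrite /off big_ord0.
rewrite offS; case: (ltnP i (off n m)) => him hi.
  by have [d [j [hd hj ->]]] := IH him; exists d, j; split=> //; lia.
by exists m, (i - off n m)%N; split; lia.
Qed.

(** The symbolic entries of x(a), each tagged with its degree: x, alpha, beta
    and the rows of A are all images of this one list, so that a fact about
    positions has to be established only once. *)
Definition entries (n : nat) : seq (nat * (nat * nat)) :=
  concat n (fun d => [seq (d, e) | e <- xblock n d]).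

Lemma concat_entries n (T : Type) (f : nat -> nat * nat -> T) :
  concat n (fun d => [seq f d e | e <- xblock n d])
  = [seq f q.1 q.2 | q <- entries n].
Proof.
rewrite /entries /concat map_flatten -map_comp; congr flatten.
by apply: eq_map => d /=; rewrite -map_comp.
Qed.

Lemma size_flatten_xblock n (T : Type) (f : nat -> nat * nat -> T) d :
  size (flatten [seq [seq f e q | q <- xblock n e] | e <- iota 0 d]) = off n d.
Proof.
rewrite size_flatten /shape -map_comp sumnE big_map /off.
rewrite -(subn0 d) -/(index_iota 0 d) big_mkord subn0.
by apply: eq_bigr => e _ /=; rewrite size_map.
Qed.

Lemma size_entries n : (2 <= n)%N -> size (entries n) = (dimp n + dimq n)%N.
Proof. by move=> hn; rewrite size_flatten_xblock off_dimpq. Qed.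

Lemma nth_entries n d j q0 : (d <= 2 * n)%N -> (j < size (xblock n d))%N ->
  nth q0 (entries n) (off n d + j) = (d, nth (0, 0)%N (xblock n d) j).
Proof.
move=> hd hj; rewrite /entries /concat.
have -> : iota 0 (2 * n).+1 = iota 0 d ++ d :: iota d.+1 (2 * n - d).
  have {1}-> : (2 * n).+1 = (d + (2 * n - d).+1)%N by lia.
  by rewrite iotaD.
rewrite map_cat flatten_cat /= nth_cat size_flatten_xblock ltnNge leq_addr /=.
by rewrite addKn nth_cat size_map hj (nth_map (0, 0)%N).
Qed.

Lemma big_off n (R : nmodType) (F : nat -> R) m :
  \sum_(i < off n m) F i
  = \sum_(d < m) \sum_(j < size (xblock n d)) F (off n d + j)%N.
Proof.
elim: m => [|m IH]; first by rewrite /off !big_ord0.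
by rewrite big_ord_recr -IH /= offS big_split_ord.
Qed.

Lemma big_entries n (R : nmodType) (F : nat -> nat * nat -> R) :
  \sum_(q <- entries n) F q.1 q.2
  = \sum_(d < (2 * n).+1) \sum_(e <- xblock n d) F d e.
Proof.
rewrite /entries /concat big_flatten big_map.
rewrite -[X in iota 0 X]subn0 -/(index_iota 0 _) big_mkord.
by apply: eq_bigr => d _; rewrite big_map.
Qed.

Lemma Jidx_off n d : (2 <= n)%N -> (d < n)%N -> Jidx d.+1 = (off n d).+1.
Proof. by move=> hn hd; rewrite /Jidx /= subn1 off_le ?(ltnW hd) // addn1. Qed.

(** The positive indices set aside in the quadratic equations are those of the linear
    entries a_{d+1}, which open the blocks of degree d < n; the block of degree
    n has no linear entry. *)
Lemma mem_Jset n d j : (2 <= n)%N -> (d <= n)%N -> (j < size (xblock n d))%N ->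
  ((off n d + j).+1 \in Jset n) = (d < n)%N && (j == 0%N).
Proof.
move=> hn hd hj; apply/mapP/andP => [[[|e] he]|[hd' /eqP->]]; first by [].
  rewrite mem_iota in he.
  have he' : (e < n)%N by lia.
  rewrite (Jidx_off hn he') => -[h].
  have /eqP := h; rewrite -[off n e]addn0 pos_inj ?(xblock_gt0 hn (ltnW he')) //.
    by case/andP=> /eqP-> ->.
  by lia.
by exists d.+1; [rewrite mem_iota; lia | rewrite addn0 (Jidx_off hn)].
Qed.

Lemma nth_xblock0 n d : (2 <= n)%N -> (d < n)%N ->
  nth (0, 0)%N (xblock n d) 0 = (d.+1, 0%N).
Proof. by move=> hn hd; rewrite xblock_lt. Qed.

Lemma nth_xblock_quad n d j : (2 <= n)%N -> (d <= n)%N ->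
  (j < size (xblock n d))%N -> ~~ ((d < n)%N && (j == 0%N)) ->
  exists u v, [/\ nth (0, 0)%N (xblock n d) j = (u, v),
                  (0 < u <= n)%N & (0 < v <= n)%N].
Proof.
move=> hn; rewrite leq_eqVlt => /predU1P[->|hd].
  rewrite xblock_diag // size_map => hj _.
  exists (nth 0%N (idx n n.+1) j), (nth 0%N (idx n n.+1) j).
  rewrite (nth_map 0%N) //; have := mem_nth 0%N hj; rewrite mem_idx.
  by case/andP.
rewrite xblock_lt // hd /=; case: j => // j; rewrite ltnS size_map => hj _ /=.
rewrite (nth_map 0%N) //; have := mem_nth 0%N hj; rewrite mem_idx => /andP[hi _].
move: (nth 0%N (idx d d.+1) j) hi => i hi.
by exists i, (n - d + i)%N; split; [by [] | lia | lia].
Qed.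

(** * Weights and the columns of the sparse matrix *)

(** A missing factor is the coefficient a_{n+1} = 1 of z^(n+1) in the numerator
    of B.  Read this way, the product a_u * conj a_v comes from the terms z^u of
    the numerator and z^(n+1-v) of the denominator, and the quotient rule gives
    it the weight u - (n + 1 - v), whatever its block. *)
Definition wt (C : numClosedFieldType) (n : nat) (e : nat * nat) : C :=
  ((if e.1 == 0 then n.+1 else e.1) + (if e.2 == 0 then n.+1 else e.2))%N%:R
  - n.+1%:R.

Lemma wt_lin (C : numClosedFieldType) n d : wt C n (d.+1, 0%N) = d.+1%:R.
Proof. by rewrite /wt /= natrD addrK. Qed.

Lemma wt_linbar (C : numClosedFieldType) n d : wt C n (0%N, d.+1) = d.+1%:R.
Proof. by rewrite /wt /= natrD addrC addKr. Qed.

Lemma wt_quad (C : numClosedFieldType) n d i : (0 < i)%N -> (d <= n)%N ->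
  wt C n (i, (n - d + i)%N) = (2 * i)%:R - d%:R - 1.
Proof.
move=> hi hd; rewrite /wt /=; case: ifPn => [|_]; first lia.
case: ifPn => [|_]; first lia.
by rewrite -(subnKC hd); move: (n - d)%N => k; rewrite addKn; ring.
Qed.

Lemma wblockE (C : numClosedFieldType) n d : (2 <= n)%N -> (d <= 2 * n)%N ->
  wblock C n d = [seq wt C n e | e <- xblock n d].
Proof.
move=> hn hd2; case: (ltngtP d n) => [hd|hd|->].
- rewrite xblock_lt //= wt_lin.
  have -> : wblock C n d
      = d.+1%:R :: [seq (2 * i)%:R - d%:R - 1 | i <- idx d d.+1].
    by rewrite /wblock; case: d hd {hd2} => [|[|d]] hd //=; rewrite hd.
  congr (_ :: _); rewrite -map_comp; apply/eq_in_map => i; rewrite mem_idx => hi /=.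
  by rewrite wt_quad //; lia.
- have -> : d = (2 * n - (2 * n - d))%N by lia.
  have : (2 * n - d < n)%N by lia.
  move: (2 * n - d)%N => {d hd hd2} d hd.
  rewrite xblock_gt // map_rcons wt_linbar.
  have -> : wblock C n (2 * n - d) = rcons [seq (2 * (n - i))%:R
      - (2 * n - d)%:R + 1 | i <- idx d d.+1] d.+1%:R.
    rewrite /wblock.
    have hsub : (2 * n - (2 * n - d) = d)%N by lia.
    rewrite hsub addn1.
    do 4 (case: ifPn => [?|_]; first lia).
    case: ifPn => [//|h]; have {h}: d = 0%N \/ d = 1%N by lia.
    by case=> ->; case: ifPn => //; lia.
  congr rcons; rewrite -map_comp; apply/eq_in_map => i; rewrite mem_idx => hi /=.
  rewrite /wt /=; case: ifPn => [|_]; first lia.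
  case: ifPn => [|_]; first lia.
  rewrite !natrB; [|lia..].
  by rewrite natrD !natrM !natrB; [ring | lia..].
- rewrite xblock_diag //.
  have -> : wblock C n n = [seq (2 * i)%:R - n%:R - 1 | i <- idx n n.+1].
    by rewrite /wblock; case: n hn {hd2} => [|[|n]] //= _; rewrite ltnn eqxx.
  rewrite -map_comp; apply/eq_in_map => i; rewrite mem_idx => hi /=.
  by rewrite -(wt_quad C (n := n)) ?subnn ?add0n //; lia.
Qed.

Definition wat (C : numClosedFieldType) (n d j : nat) : C :=
  wt C n (nth (0, 0)%N (xblock n d) j).

Lemma wat_lin (C : numClosedFieldType) n d : (2 <= n)%N -> (d < n)%N ->
  wat C n d 0 = d.+1%:R.
Proof. by move=> hn hd; rewrite /wat nth_xblock0 // wt_lin. Qed.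

Lemma wat_nth_idx (C : numClosedFieldType) n d j : (2 <= n)%N -> (d <= n)%N ->
  (j < d - odd d)%N ->
  wat C n d (j + (d < n)%N) = (2 * nth 0%N (idx d d.+1) j)%:R - d%:R - 1.
Proof.
move=> hn + hj; have hi : (0 < nth 0%N (idx d d.+1) j)%N by rewrite nth_idx.
rewrite /wat leq_eqVlt => /predU1P[ed|hd].
  rewrite {d}ed in hj hi *; rewrite ltnn addn0 xblock_diag //.
  rewrite (nth_map 0%N) ?size_idx // -(wt_quad C (n := n)) //.
  by rewrite subnn add0n.
rewrite hd addn1 xblock_lt //= (nth_map 0%N) ?size_idx //.
by rewrite wt_quad // ltnW.
Qed.

Lemma wat_low (C : numClosedFieldType) n d j : (2 <= n)%N -> (d <= n)%N ->
  (j < d - odd d)%N -> (odd d -> j < d./2)%N ->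
  wat C n d (j + (d < n)%N) = 2 * j%:R + 1 - d%:R.
Proof.
move=> hn hd hj hlow; rewrite wat_nth_idx // nth_idx //.
have -> : (odd d && (d./2 <= j)%N = false).
  by apply/negbTE; case: (odd d) hlow => //= /(_ isT); rewrite -ltnNge.
by rewrite addn0; ring.
Qed.

Lemma wat_high (C : numClosedFieldType) n d j : (2 <= n)%N -> (d <= n)%N ->
  (j < d - odd d)%N -> odd d -> (d./2 <= j)%N ->
  wat C n d (j + (d < n)%N) = 2 * j%:R + 3 - d%:R.
Proof.
move=> hn hd hj od hhigh; rewrite wat_nth_idx // nth_idx // od hhigh.
by rewrite addn1; ring.
Qed.

(** The entry omitted for odd [d] is exactly the one of weight zero. *)
Lemma wat_neq0 (C : numClosedFieldType) n d j : (2 <= n)%N -> (d <= n)%N ->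
  (j < size (xblock n d))%N -> wat C n d j != 0.
Proof.
move=> hn hd; rewrite size_xblock // => hj.
have [/andP[hdn /eqP->]|h] := boolP ((d < n)%N && (j == 0%N)).
  by rewrite wat_lin // pnatr_eq0.
have [i ei] : exists i, j = (i + (d < n)%N)%N.
  by exists (j - (d < n)%N)%N; case: (ltnP d n) h => /= hdn h; lia.
rewrite {j}ei in hj h *; rewrite ltn_add2r in hj; move: (hj) => hi.
have [/andP[od hdi]|hlow] := boolP (odd d && (d./2 <= i)%N).
  rewrite wat_high // -natrM -natrD subr_eq0 eqr_nat.
  by apply/eqP; lia.
have {}hlow : (odd d -> i < d./2)%N by move=> od; move: hlow; rewrite od -ltnNge.
rewrite wat_low // -natrM -(natrD _ _ 1) subr_eq0 eqr_nat.
by apply/eqP; lia.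
Qed.

Lemma nth_pair (R : nzSemiRingType) r s (a b : R) i :
  (nseq r 0 ++ [:: a; b] ++ nseq s 0)`_i = a *+ (i == r) + b *+ (i == r.+1).
Proof.
rewrite nth_cat size_nseq; case: ltnP => hi.
  by rewrite nth_nseq hi !(ltn_eqF _) ?addr0 //; lia.
rewrite -(subnKC hi) addKn; move: (i - r)%N => k.
have -> : (r + k == r)%N = (k == 0)%N by rewrite -{2}[r]addn0 eqn_add2l.
have -> : (r + k == r.+1)%N = (k == 1)%N by rewrite -[r.+1]addn1 eqn_add2l.
by case: k => [|[|k]] /=; rewrite ?addr0 ?add0r // nth_nseq if_same.
Qed.

(** Each column of C^d is a multiple of the obvious kernel vector of a pair of
    neighbouring weights, (w_{j+1}, - w_j).  The factor is 1, except for -1 in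
    the first column when d < n, and 1/2 in the column that straddles the
    omitted entry, whose neighbours have weights -2 and 2. *)
Lemma vcolE (C : numClosedFieldType) n d j : (2 <= n)%N -> (2 <= d <= n)%N ->
  (j.+1 < size (xblock n d))%N ->
  exists mu s, mu != 0 /\ vcol C n d (j + if (d < n)%N then 1 else 2)%N
    = nseq j 0 ++ [:: mu * wat C n d j.+1; - (mu * wat C n d j)] ++ nseq s 0.
Proof.
move=> hn /andP[hd2 hdn]; rewrite size_xblock // => hj.
rewrite /vcol; case: ifP => hd; rewrite hd in hj; last first.
  have low i : (i < d - odd d)%N -> (odd d -> i < d./2)%N ->
      wat C n d i = 2 * i%:R + 1 - d%:R.
    by move=> h1 h2; rewrite -(wat_low C (n := n)) // hd addn0.
  have high i : (i < d - odd d)%N -> odd d -> (d./2 <= i)%N ->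
      wat C n d i = 2 * i%:R + 3 - d%:R.
    by move=> h1 h2 h3; rewrite -(wat_high C (n := n)) // hd addn0.
  rewrite hd !addn2 !subn2 /=; case: (boolP (odd d)) hj => od hj /=.
    case: ifPn => h1; last case: ifPn => h2.
    - exists 1, (d - j.+2 - 1)%N; split; first exact: oner_neq0.
      rewrite !low; [|lia..].
      congr (_ ++ _ :: _ :: _); ring.
    (* the weights on both sides of the omitted entry are -2 and 2 *)
    - exists (2^-1), ((d - 3)./2)%N; split; first by rewrite invr_eq0 pnatr_eq0.
      have ej : j = (d - 3)./2 by lia.
      rewrite (low j) ?(high j.+1); [|lia..].
      have -> : (d%:R : C) = 2 * j%:R + 3 by rewrite -natrM -natrD; congr _%:R; lia.
      by rewrite -ej; congr (_ ++ _ :: _ :: _); field; rewrite ?pnatr_eq0.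
    - exists 1, (d - j.+2 - 1)%N; split; first exact: oner_neq0.
      rewrite !high; [|lia..].
      by congr (_ ++ _ :: _ :: _); ring.
  exists 1, (d - j.+2)%N; split; first exact: oner_neq0.
  rewrite !low; [|lia..].
  by congr (_ ++ _ :: _ :: _); ring.
have w0 : wat C n d 0 = d.+1%:R by exact: wat_lin.
have low i : (i < d - odd d)%N -> (odd d -> i < d./2)%N ->
    wat C n d i.+1 = 2 * i%:R + 1 - d%:R.
  by move=> h1 h2; rewrite -(wat_low C (n := n)) // hd addn1.
have high i : (i < d - odd d)%N -> odd d -> (d./2 <= i)%N ->
    wat C n d i.+1 = 2 * i%:R + 3 - d%:R.
  by move=> h1 h2 h3; rewrite -(wat_high C (n := n)) // hd addn1.
rewrite hd !addn1 !subn1 /= eqSS; case: j hj => [|j] hj /=.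
  rewrite w0 low; [|lia..].
  case: (boolP (odd d)) hj => od hj /=; exists (-1).
    exists (d - 2)%N; split; first by rewrite oppr_eq0 oner_neq0.
    by congr (_ :: _ :: _); ring.
  exists d.-1; split; first by rewrite oppr_eq0 oner_neq0.
  by congr (_ :: _ :: _); ring.
case: (boolP (odd d)) hj => od hj /=; last first.
  exists 1, (d - j.+2)%N; split; first exact: oner_neq0.
  rewrite !low; [|lia..].
  by congr (_ :: _ ++ _ :: _ :: _); ring.
case: ifPn => h1; last case: ifPn => h2.
- exists 1, (d - j.+2).-1; split; first exact: oner_neq0.
  rewrite !low; [|lia..].
  by congr (_ :: _ ++ _ :: _ :: _); ring.
(* the weights on both sides of the omitted entry are -2 and 2 *)
- exists (2^-1), ((d - 3)./2)%N; split; first by rewrite invr_eq0 pnatr_eq0.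
  have ej : d.-1./2 = j.+1 by lia.
  rewrite (low j) ?(high j.+1); [|lia..].
  have -> : (d%:R : C) = 2 * j%:R + 3 by rewrite -natrM -natrD; congr _%:R; lia.
  by rewrite ej; congr (_ :: _ ++ _ :: _ :: _); field; rewrite ?pnatr_eq0.
- exists 1, (d - j.+2).-1; split; first exact: oner_neq0.
  rewrite !high; [|lia..].
  by congr (_ :: _ ++ _ :: _ :: _); ring.
Qed.
(** * The range of the sparse matrix is the kernel of the weights *)

Lemma extS (C : numClosedFieldType) N (v : 'cV[C]_N) (i : 'I_N) :
  ext v i.+1 = v i 0.
Proof.
rewrite /ext /= (nth_map i) ?size_enum_ord //.
by congr (v _ _); apply: val_inj; rewrite /= nth_enum_ord.
Qed.

Lemma cV_ext (C : numClosedFieldType) N (u v : 'cV[C]_N) :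
  (forall i, (i < N)%N -> ext u i.+1 = ext v i.+1) -> u = v.
Proof.
move=> h; apply/matrixP => i j; rewrite (ord1 j).
by rewrite -!extS; apply: h.
Qed.

Lemma ext_default (C : numClosedFieldType) N (v : 'cV[C]_N) i :
  (N <= i)%N -> ext v i.+1 = 0.
Proof. by move=> h; rewrite /ext /= nth_default // size_map size_enum_ord. Qed.

Lemma ext_col (C : numClosedFieldType) N (f : nat -> C) i :
  (i < N)%N -> ext (\col_(k < N) f k) i.+1 = f i.
Proof. by move=> hi; rewrite (_ : i = Ordinal hi :> nat) // extS mxE. Qed.

Lemma extD (C : numClosedFieldType) N (u v : 'cV[C]_N) i :
  ext (u + v) i.+1 = ext u i.+1 + ext v i.+1.
Proof.
case: (ltnP i N) => hi; last by rewrite !ext_default // addr0.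
by rewrite (_ : i = Ordinal hi :> nat) // !extS mxE.
Qed.

Lemma extZ (C : numClosedFieldType) N (c : C) (u : 'cV[C]_N) i :
  ext (c *: u) i.+1 = c * ext u i.+1.
Proof.
case: (ltnP i N) => hi; last by rewrite !ext_default // mulr0.
by rewrite (_ : i = Ordinal hi :> nat) // !extS mxE.
Qed.

Definition wdot (C : numClosedFieldType) n d (x : 'cV[C]_(dimp n)) : C :=
  \sum_(j < size (xblock n d)) wat C n d j * ext x (off n d + j).+1.

Lemma wdotD (C : numClosedFieldType) n d (x y : 'cV[C]_(dimp n)) :
  wdot d (x + y) = wdot d x + wdot d y.
Proof.
by rewrite /wdot -big_split /=; apply: eq_bigr => j _; rewrite extD mulrDr.
Qed.

Lemma wdotZ (C : numClosedFieldType) n d c (x : 'cV[C]_(dimp n)) :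
  wdot d (c *: x) = c * wdot d x.
Proof.
by rewrite /wdot mulr_sumr; apply: eq_bigr => j _; rewrite extZ mulrCA.
Qed.

Definition epos (C : numClosedFieldType) n (i : nat) : 'cV[C]_(dimp n) :=
  \col_k (k == i :> nat)%:R.

Lemma ext_epos (C : numClosedFieldType) n i k : (k < dimp n)%N ->
  ext (epos C n i) k.+1 = (k == i)%:R.
Proof. exact: (@ext_col C _ (fun k => (k == i)%:R)). Qed.

Lemma off_lt_dimp n d j : (2 <= n)%N -> (d <= n)%N ->
  (j < size (xblock n d))%N -> (off n d + j < dimp n)%N.
Proof.
move=> hn hd hj; rewrite -off_dimp //.
have /(off_lt hn) : (d < n.+1 <= n.+1)%N by lia.
by apply: leq_trans; rewrite ltn_add2l.
Qed.

Lemma wdot_epos (C : numClosedFieldType) n d e j : (2 <= n)%N ->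
  (d <= n)%N -> (e <= n)%N -> (j < size (xblock n e))%N ->
  wdot d (epos C n (off n e + j)) = wat C n e j *+ (d == e).
Proof.
move=> hn hd he hj; rewrite /wdot.
transitivity (\sum_(i < size (xblock n d))
    wat C n d i *+ ((d == e) && (i == j :> nat))).
  apply: eq_bigr => i _; rewrite ext_epos ?off_lt_dimp // pos_inj //.
  by rewrite mulr_natr.
case: eqP => [ed|_]; last by rewrite big1.
rewrite -{e}ed in he hj *.
rewrite (bigD1 (Ordinal hj)) //= eqxx big1 ?addr0 // => i.
by rewrite -val_eqE /= => /negbTE ->.
Qed.

Lemma Chat_colP (C : numClosedFieldType) n d j : (2 <= n)%N ->
  (2 <= d <= n)%N -> (j.+1 < size (xblock n d))%N ->
  exists2 mu : C, mu != 0 & 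
  colv (dimp n) (nseq (\sum_(e < d) size (xblock n e))%N 0
                   ++ vcol C n d (j + if (d < n)%N then 1 else 2)%N)
  = mu *: (wat C n d j.+1 *: epos C n (off n d + j)
           - wat C n d j *: epos C n (off n d + j).+1).
Proof.
move=> hn hd hj; have [mu [s [mu0 ->]]] := vcolE C hn hd hj.
exists mu => //; apply/matrixP => r k; rewrite !mxE -/(off n d).
rewrite catA -nseqD nth_pair [RHS]mulrBr; congr (_ + _).
  by rewrite mulrA mulr_natr.
by rewrite mulrA mulr_natr mulNrn.
Qed.

Lemma mem_vrange n d k : (2 <= n)%N -> (2 <= d <= n)%N ->
  k \in vrange n d ->
  exists2 j, (j.+1 < size (xblock n d))%N & k = (j + if (d < n) then 1 else 2)%N.
Proof.
move=> hn /andP[hd2 hd]; rewrite /vrange mem_index_iota size_xblock //.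
move=> h; exists (k - if d < n then 1 else 2)%N; move: h;
  by case: (d < n)%N; case: (odd d) => /=; lia.
Qed.

Lemma vrange_mem n d j : (2 <= n)%N -> (2 <= d <= n)%N ->
  (j.+1 < size (xblock n d))%N ->
  (j + if (d < n) then 1 else 2)%N \in vrange n d.
Proof.
move=> hn /andP[hd2 hd]; rewrite /vrange mem_index_iota size_xblock //.
by case: (d < n)%N; case: (odd d) => /=; lia.
Qed.

Lemma size_vrange n d : (2 <= n)%N -> (2 <= d <= n)%N ->
  (size (vrange n d)).+1 = size (xblock n d).
Proof.
move=> hn /andP[hd2 hd]; rewrite /vrange size_iota size_xblock //.
by case: (d < n)%N; case: (odd d) => /=; lia.
Qed.

Lemma size_Chat_cols (C : numClosedFieldType) n : (2 <= n)%N ->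
  size (Chat_cols C n) = (dimm n - 1)%N.
Proof.
move=> hn; rewrite /Chat_cols.
have aux k : (k < n)%N -> 
    (size (flatten [seq [seq (nseq (\sum_(e < d) size (xblock n e))%N 0%R
       ++ vcol C n d i)%SEQ | i <- vrange n d] | d <- iota 2 k]) + k + 2
     = off n k.+2)%N.
  elim: k => [_|k IH hk].
    by rewrite off_le.
  rewrite -{1}[k.+1]addn1 iotaD map_cat flatten_cat size_cat /= cats0 size_map.
  rewrite offS -IH ?(ltnW hk) // -size_vrange // add2n.
  move: (size (flatten _)) (size (vrange _ _)) => u v; lia.
have hn1 : (n.-1 < n)%N by lia.
have en : n.-1.+2 = n.+1 by lia.
have := aux _ hn1; rewrite en off_dimp // /dimp.
by move: (size (flatten _)) => u; lia.
Qed.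

(** Weights pair to zero with the columns of their own block, and the columns
    of another block have no entry where the weights are. *)
Lemma wdot_Chat (C : numClosedFieldType) n d (t : 'cV[C]_(dimm n - 1)) :
  (2 <= n)%N -> (d <= n)%N -> wdot d (Chat C n *m t) = 0.
Proof.
move=> hn hd.
have colE (r : 'I_(dimm n - 1)) : wdot d (col r (Chat C n)) = 0.
  have : nth [::] (Chat_cols C n) r \in Chat_cols C n.
    by rewrite mem_nth // size_Chat_cols.
  have -> : col r (Chat C n) = colv (dimp n) (nth [::] (Chat_cols C n) r).
    by apply/matrixP => i k; rewrite !mxE.
  case/flattenP => s /mapP[e]; rewrite mem_iota => he ->{s}.
  have {}he : (2 <= e <= n)%N by lia.
  have he' : (e <= n)%N by lia.
  case/mapP => k /(mem_vrange hn he)[j hj ->] ->.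
  have [mu _ ->] := Chat_colP C hn he hj.
  rewrite -addnS wdotZ wdotD -scaleNr !wdotZ !wdot_epos // ?(ltnW hj) //.
  by case: eqP => _; rewrite /= ?mulr0n; ring.
have -> : Chat C n *m t = \sum_r t r 0 *: col r (Chat C n).
  apply/matrixP => i j; rewrite (ord1 j) mxE summxE; apply: eq_bigr => r _.
  by rewrite !mxE mulrC.
elim/big_rec: _ => [|r y _ hy].
  by rewrite -(scale0r 0) wdotZ mul0r.
by rewrite wdotD wdotZ colE hy mulr0 addr0.
Qed.

(** Modulo the columns, the [j]-th unit vector of a block is w_j / w_0 times the
    first one, because all weights are nonzero.  The block of y is therefore
    congruent to (w . y) / w_0 times the first unit vector, which is zero on the
    kernel. *)
Lemma Chat_ker (C : numClosedFieldType) n (y : 'cV[C]_(dimp n)) :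
  (2 <= n)%N -> (forall d, (d <= n)%N -> wdot d y = 0) ->
  exists t, y = Chat C n *m t.
Proof.
move=> hn hy; pose S (v : 'cV[C]_(dimp n)) := (v^T <= (Chat C n)^T)%MS.
suff /submxP[D hD] : S y by exists D^T; rewrite -[LHS]trmxK hD trmx_mul trmxK.
have SD u v : S u -> S v -> S (u + v) by rewrite /S linearD; exact: addmx_sub.
have SZ c v : S v -> S (c *: v) by rewrite /S linearZ; exact: scalemx_sub.
have S0 : S 0 by rewrite /S trmx0 sub0mx.
have Scol d j : (d <= n)%N -> (j.+1 < size (xblock n d))%N ->
    S (wat C n d j.+1 *: epos C n (off n d + j)
           - wat C n d j *: epos C n (off n d + j).+1).
  move=> hd hj; have h2d : (2 <= d <= n)%N.
    rewrite hd andbT; case: d hd hj => [|[|d]] hd //;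
      by rewrite size_xblock //=; lia.
  have [mu mu0 colE] := Chat_colP C hn h2d hj.
  rewrite -[X in S X]scale1r -(mulVf mu0) -scalerA -colE; apply: SZ.
  set s := _ ++ _.
  have hs : s \in Chat_cols C n.
    apply/flattenP; exists [seq nseq (\sum_(e < d) size (xblock n e))%N 0
                 ++ vcol C n d k | k <- vrange n d].
      by apply/map_f; rewrite mem_iota; lia.
    exact/map_f/vrange_mem.
  have hr : (index s (Chat_cols C n) < dimm n - 1)%N.
    by rewrite -(size_Chat_cols C) // index_mem.
  rewrite /S (_ : _^T = row (Ordinal hr) (Chat C n)^T) ?row_sub //.
  by apply/matrixP => i k; rewrite !mxE nth_index.
have Sdiff d j : (d <= n)%N -> (j < size (xblock n d))%N ->
    S (epos C n (off n d + j)
       - (wat C n d j / wat C n d 0) *: epos C n (off n d)).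
  move=> hd; elim: j => [|j IH] hj.
    by rewrite addn0 divff ?wat_neq0 // scale1r subrr.
  have wj0 : wat C n d j != 0 by rewrite wat_neq0 // ltnW.
  have w00 : wat C n d 0 != 0 by rewrite wat_neq0 // (leq_trans _ hj).
  have := SD _ _ (SZ (wat C n d j.+1 / wat C n d j) _ (IH (ltnW hj)))
             (SZ (- (wat C n d j)^-1) _ (Scol d j hd hj)).
  congr (S _); apply/matrixP => i k; rewrite !mxE addnS.
  by field; rewrite wj0 w00.
have -> : y = \sum_(d < n.+1) \sum_(j < size (xblock n d))
    ext y (off n d + j).+1 *: epos C n (off n d + j).
  transitivity (\sum_(i < dimp n) ext y i.+1 *: epos C n i).
    apply/matrixP => i k; rewrite (ord1 k) summxE (bigD1 i) //= big1.
      by rewrite !mxE eqxx mulr1 addr0 extS.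
    move=> r /negbTE hr; rewrite !mxE (_ : (i == r :> nat) = false) ?mulr0 //.
    by rewrite eq_sym.
  pose F i := ext y i.+1 *: epos C n i.
  by have := big_off n F n.+1; rewrite off_dimp.
have SS I (r : seq I) (F : I -> 'cV[C]_(dimp n)) :
    (forall i, S (F i)) -> S (\sum_(i <- r) F i).
  by move=> h; elim/big_rec: _ => // i x _; apply: SD.
apply: (SS _) => -[d /= hd].
have -> : \sum_(j < size (xblock n d)) ext y (off n d + j).+1
             *: epos C n (off n d + j)
  = \sum_(j < size (xblock n d)) ext y (off n d + j).+1
        *: (epos C n (off n d + j)
            - (wat C n d j / wat C n d 0) *: epos C n (off n d)).
  under [RHS]eq_bigr do rewrite scalerBr scalerA.
  rewrite sumrB -scaler_suml.
  under [X in _ - X *: _]eq_bigr do rewrite mulrA.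
  have hyd : \sum_(j < size (xblock n d))
      ext y (off n d + j).+1 * wat C n d j = 0.
    by rewrite -[RHS](hy d hd); apply: eq_bigr => j _; rewrite mulrC.
  by rewrite -mulr_suml hyd mul0r scale0r subr0.
by apply: SS => j; apply/SZ/Sdiff.
Qed.

(** * The sparse system in terms of weights *)

Definition hat (C : numClosedFieldType) n (f : nat -> nat * nat -> C) :
    'cV[C]_(dimp n) :=
  usubmx (colv (dimp n + dimq n) [seq f q.1 q.2 | q <- entries n]).

Lemma xhatE (C : numClosedFieldType) n (a : 'cV[C]_n) :
  xhat a = hat n (fun _ => monom a).
Proof. by rewrite /xhat /xvec (concat_entries n (fun _ => monom a)). Qed.

Lemma alphahatE (C : numClosedFieldType) n (z : 'I_n -> C) :
  alphahat z = hat n (fun _ => alpha_entry z).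
Proof. by rewrite /alphahat (concat_entries n (fun _ => alpha_entry z)). Qed.

Lemma betahatE (C : numClosedFieldType) n (z : 'I_n -> C) :
  betahat z
  = hat n (fun d e => if d == n then ycoef C n e.1 else alpha_entry z e).
Proof.
rewrite /betahat.
by rewrite (concat_entries n
              (fun d e => if d == n then ycoef C n e.1 else alpha_entry z e)).
Qed.

Lemma ext_hat (C : numClosedFieldType) n (f : nat -> nat * nat -> C) d j :
  (2 <= n)%N -> (d <= n)%N -> (j < size (xblock n d))%N ->
  ext (hat n f) (off n d + j).+1 = f d (nth (0, 0)%N (xblock n d) j).
Proof.
move=> hn hd hj; have hp := off_lt_dimp hn hd hj.
transitivity ([seq f q.1 q.2 | q <- entries n]`_(off n d + j)).
  by rewrite (_ : (off n d + j)%N = Ordinal hp) // extS /hat /colv !mxE.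
rewrite (nth_map (0, (0, 0))%N); last by rewrite size_entries // ltn_addr.
by rewrite nth_entries //; lia.
Qed.

Lemma wdot_hat (C : numClosedFieldType) n (f : nat -> nat * nat -> C) d :
  (2 <= n)%N -> (d <= n)%N ->
  wdot d (hat n f) = \sum_(e <- xblock n d) wt C n e * f d e.
Proof.
move=> hn hd; rewrite (big_nth (0, 0)%N) big_mkord.
by apply: eq_bigr => j _; rewrite ext_hat.
Qed.

Lemma ycoefE (C : numClosedFieldType) n i : (2 <= n)%N -> (0 < i <= n)%N ->
  ycoef C n i = 3 * ((2 * i)%:R - n%:R - 1) / (n * (n - 1))%:R.
Proof.
move=> hn hi; rewrite /ycoef /ylow; case: ifP => _.
  by rewrite -natr1 -mulNr; congr (_ / _); ring.
rewrite opprK natrM natrB; last by lia.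
by rewrite -natr1 natrM; congr (_ / _); ring.
Qed.

Lemma sum_sqr_weights (C : numClosedFieldType) (c : C) m :
  3 * \sum_(i <- iota 1 m) ((2 * i)%:R - c) ^+ 2
  = 2 * m%:R * (m%:R + 1) * (2 * m%:R + 1)
    - 6 * c * m%:R * (m%:R + 1) + 3 * m%:R * c ^+ 2.
Proof.
elim: m => [|m IH]; first by rewrite big_nil; ring.
rewrite -{1}[m.+1]addn1 iotaD big_cat /= big_seq1 mulrDr IH add1n natrM -natr1.
by ring.
Qed.

(** The y_i are proportional to the weights 2i - n - 1, whose squares add up to
    n (n^2 - 1) / 3; the factor 3 / (n (n - 1)) turns this into n + 1, the middle
    coefficient of the normalized W_0. *)
Lemma sum_ycoef (C : numClosedFieldType) n : (2 <= n)%N ->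
  \sum_(e <- xblock n n) wt C n e * ycoef C n e.1 = n.+1%:R.
Proof.
move=> hn; rewrite xblock_diag // big_map /= big_filter.
have n0 : n%:R != 0 :> C by rewrite pnatr_eq0; lia.
have n1 : n%:R - 1 != 0 :> C by rewrite subr_eq0 pnatr_eq1; apply/eqP; lia.
transitivity (\sum_(i <- iota 1 n)
    ((2 * i)%:R - (n%:R + 1)) ^+ 2 * (3 / (n * (n - 1))%:R) : C).
  rewrite big_mkcond; apply: eq_big_seq => i; rewrite mem_iota => hi.
  case: ifPn => [_|/negPn/eqP hin]; last by rewrite hin -natr1 subrr expr0n mul0r.
  rewrite ycoefE //.
  rewrite (_ : wt C n (i, i) = (2 * i)%:R - n%:R - 1); last first.
    by rewrite -(wt_quad C (n := n)) ?subnn ?add0n //; lia.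
  by rewrite -(addrA _ (- _)) -opprD; ring.
rewrite -mulr_suml mulrA [_ * 3]mulrC sum_sqr_weights natrM natrB; last by lia.
by rewrite -natr1; field; rewrite n0 n1.
Qed.

Lemma alpha_quad (C : numClosedFieldType) n (z : 'I_n -> C) u v :
  (0 < u)%N -> (0 < v)%N -> alpha_entry z (u, v) = 0.
Proof. by rewrite /alpha_entry /= !lt0n => /negbTE-> /negbTE->. Qed.

Lemma sum_lin (C : numClosedFieldType) n (z : 'I_n -> C) d :
  (2 <= n)%N -> (d < n)%N ->
  \sum_(e <- xblock n d) wt C n e * alpha_entry z e = ccoef z d.
Proof.
move=> hn hd; rewrite xblock_lt // big_cons wt_lin big_map big_seq big1.
  by rewrite addr0 /alpha_entry /= /scoef mulrC divfK ?pnatr_eq0.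
by move=> i; rewrite mem_idx => hi; rewrite alpha_quad ?mulr0 //; lia.
Qed.

Lemma wdot_alphahat (C : numClosedFieldType) n (z : 'I_n -> C) d :
  (2 <= n)%N -> (d <= n)%N ->
  wdot d (alphahat z) = if (d < n)%N then ccoef z d else 0.
Proof.
move=> hn hd; rewrite alphahatE wdot_hat //; case: ltnP => hdn.
  exact: sum_lin.
have -> : d = n by lia.
rewrite xblock_diag // big_map big_seq big1 // => i; rewrite mem_idx => hi.
by rewrite alpha_quad ?mulr0 //; lia.
Qed.

Lemma wdot_betahat (C : numClosedFieldType) n (z : 'I_n -> C) d :
  (2 <= n)%N -> (d <= n)%N ->
  wdot d (betahat z) = if (d < n)%N then ccoef z d else n.+1%:R.
Proof.
move=> hn hd; rewrite betahatE wdot_hat //; case: ltngtP hd => // [hdn|->] _.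
  exact: sum_lin.
exact: sum_ycoef.
Qed.

(** Both alpha and beta realize the coefficients c_d in degrees d < n, while in
    degree n only beta contributes.  Adding the term (n + 1) z^n of the numerator
    of B', which the unknowns do not carry, turns the right-hand side into
    (1 + tb) c_d in every degree d <= n. *)
Lemma sparse_linearP (C : numClosedFieldType) n (z : 'I_n -> C)
    (x : 'cV[C]_(dimp n)) (tb : C) : (2 <= n)%N ->
  (exists t, x = alphahat z + Chat C n *m t + tb *: betahat z) <->
  (forall d, (d <= n)%N -> wdot d x
     = if (d < n)%N then (1 + tb) * ccoef z d else tb * n.+1%:R).
Proof.
move=> hn; split=> [[t ->] d hd|hx].
  rewrite !wdotD wdotZ wdot_alphahat // wdot_betahat // wdot_Chat // addr0.
  by case: ifP => _; rewrite ?add0r // mulrDl mul1r.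
have [d hd|t ht] := @Chat_ker C n (x - alphahat z - tb *: betahat z) hn.
  rewrite -!scaleN1r !wdotD !wdotZ hx // wdot_alphahat // wdot_betahat //.
  by case: ifP => _; ring.
by exists t; rewrite -ht -addrA subrK addrC subrK.
Qed.

(** * The quadratic equations *)

Definition quadratic_eqs (C : numClosedFieldType) n (x : 'cV[C]_(dimp n)) :=
  forall i : nat, (i <= dimp n)%N -> i \notin Jset n ->
    ext x i = ext x (Jidx (Iidx n i)) * (ext x (Jidx (Ibar n i)))^*.

Lemma index_entry n d j : (2 <= n)%N -> (d <= n)%N ->
  (j < size (xblock n d))%N ->
  (Iidx n (off n d + j).+1, Ibar n (off n d + j).+1)
  = nth (0, 0)%N (xblock n d) j.
Proof.
move=> hn hd hj; rewrite /Iidx /Ibar -surjective_pairing.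
rewrite -[nth _ (_ :: _) _]/(nth _ (concat _ _) _).
have -> : concat n (xblock n) = [seq q.2 | q <- entries n].
  rewrite -(concat_entries n (fun _ e => e)) /concat; congr flatten.
  by apply: eq_map => e; rewrite map_id.
have hp := off_lt_dimp hn hd hj.
rewrite (nth_map (0, (0, 0))%N); last by rewrite size_entries // ltn_addr.
by rewrite nth_entries //; lia.
Qed.

Lemma ext_xhat_Jidx (C : numClosedFieldType) n (a : 'cV[C]_n) i :
  (2 <= n)%N -> (0 < i <= n)%N -> ext (xhat a) (Jidx i) = ext a i.
Proof.
move=> hn; case: i => [//|d] /= hd.
have h0 := xblock_gt0 hn (ltnW hd).
rewrite (Jidx_off hn hd).
rewrite -(addn0 (off n d)).
rewrite xhatE.
rewrite (ext_hat _ hn (ltnW hd) h0).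
rewrite nth_xblock0 //.
by rewrite /monom /= [X in _ * X]conjC1 mulr1.
Qed.

Lemma quadratic_eqs_xhat (C : numClosedFieldType) n (a : 'cV[C]_n) :
  (2 <= n)%N -> quadratic_eqs (xhat a).
Proof.
move=> hn [|i] hi; first by [].
rewrite -off_dimp // in hi; have [d [j [hd hj ei]]] := posP hi.
rewrite ltnS in hd; rewrite {i hi}ei mem_Jset // => hJ.
have [u [v [euv hu hv]]] := nth_xblock_quad hn hd hj hJ.
have := index_entry hn hd hj; rewrite euv => -[-> ->].
by rewrite !ext_xhat_Jidx // xhatE ext_hat // euv.
Qed.

Lemma quadratic_eqsP (C : numClosedFieldType) n (x : 'cV[C]_(dimp n)) :
  (2 <= n)%N -> quadratic_eqs x -> exists a, x = xhat a.
Proof.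
move=> hn hx; exists (\col_(k < n) ext x (Jidx k.+1)).
set a := \col_k _.
have aE i : (0 < i <= n)%N -> ext a i = ext x (Jidx i).
  case: i => // i hi; exact: (@ext_col C n (fun k => ext x (Jidx k.+1))).
apply: cV_ext => i; rewrite -{1}(off_dimp hn) => /posP[d [j [hd hj ->]]].
rewrite ltnS in hd; rewrite xhatE ext_hat //.
have [/andP[hdn /eqP->]|hJ] := boolP ((d < n)%N && (j == 0)%N).
  rewrite nth_xblock0 // /monom /= [X in _ * X]conjC1 mulr1 aE //.
  by rewrite (Jidx_off hn hdn) addn0.
have [u [v [euv hu hv]]] := nth_xblock_quad hn hd hj hJ.
rewrite hx ?mem_Jset //; last exact: off_lt_dimp.
have := index_entry hn hd hj; rewrite euv => -[-> ->].
by rewrite /monom /= !aE.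
Qed.

(** * Self-inversive polynomials *)

(** The second clause says z^(2n) conj (p (1 / conj z)) = p z. *)
Definition self_inversive (C : numClosedFieldType) n (p : {poly C}) :=
  (size p <= (2 * n).+1)%N
  /\ forall d, (d <= 2 * n)%N -> (p`_d)^* = p`_(2 * n - d).

(** Polynomials of this form are self-inversive for Hermitian [h]; both the
    numerator of B' and, up to a factor, W_0 are of this form. *)
Definition herm (C : numClosedFieldType) n (h : nat -> nat -> C) : {poly C} :=
  \sum_(u < n.+1) \sum_(v < n.+1) h u v *: 'X^(u + n - v).

Lemma coef_herm (C : numClosedFieldType) n (h : nat -> nat -> C) d :
  (herm n h)`_d
  = \sum_(u < n.+1) \sum_(v < n.+1) h u v *+ (u + n == d + v)%N.
Proof.
rewrite coef_sum; apply: eq_bigr => u _; rewrite coef_sum; apply: eq_bigr => v _.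
rewrite coefZ coefXn mulr_natr; congr (_ *+ nat_of_bool _).
by have hv := ltn_ord v; apply/idP/idP => /eqP ?; apply/eqP; lia.
Qed.

Lemma coef_herm_low (C : numClosedFieldType) n (h : nat -> nat -> C) d :
  (d <= n)%N -> (herm n h)`_d = \sum_(u < d.+1) h u (n - d + u)%N.
Proof.
move=> hd; rewrite coef_herm (big_ord_widen n.+1 (fun u => h u (n - d + u)%N)) //.
rewrite [RHS]big_mkcond; apply: eq_bigr => u _; rewrite ltnS.
case: leqP => hu; last first.
  by rewrite big1 // => v _; have := ltn_ord v; case: eqP => //; lia.
have hv : (n - d + u < n.+1)%N by lia.
rewrite (bigD1 (Ordinal hv)) //= big1 ?addr0.
  by case: eqP => //; lia.
move=> v hne; rewrite (_ : (u + n == d + v)%N = false) //; apply/negbTE.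
by apply: contraNneq hne => huv; apply/eqP/val_inj => /=; lia.
Qed.

Lemma herm_self_inversive (C : numClosedFieldType) n (h : nat -> nat -> C) :
  (forall u v, (h u v)^* = h v u) -> self_inversive n (herm n h).
Proof.
move=> hh; split=> [|d hd].
  apply/leq_sizeP => j hj; rewrite coef_herm big1 // => u _; rewrite big1 // => v _.
  by have := ltn_ord u; case: eqP => //; lia.
rewrite !coef_herm exchange_big rmorph_sum; apply: eq_bigr => v _.
rewrite rmorph_sum; apply: eq_bigr => u _; rewrite rmorphMn /= hh.
by congr (_ *+ nat_of_bool _); apply/idP/idP => /eqP ?; apply/eqP; lia.
Qed.

Lemma self_inversive_root (C : numClosedFieldType) n (p : {poly C}) x :
  self_inversive n p -> x != 0 -> root p x -> root p (x^*)^-1.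
Proof.
move=> [sp hp] x0 /eqP px; apply/eqP.
have y0 : x^* != 0 by rewrite conjC_eq0.
apply: (mulfI (expf_neq0 (2 * n) y0)); rewrite mulr0.
rewrite -[RHS](rmorph0 Num.conj) -px !(horner_coef_wide _ sp).
rewrite rmorph_sum mulr_sumr (reindex_inj rev_ord_inj) /=.
apply: eq_bigr => i _; rewrite rmorphM rmorphXn /= hp -1?ltnS //.
rewrite subSS mulrCA; congr (_ * _).
rewrite -{1}(subnK (_ : i <= 2 * n)%N) -1?ltnS // addnC exprD exprVn.
by rewrite -mulrA divff ?mulr1 // expf_neq0.
Qed.

(** The conjugate reciprocal of [p] with respect to the degree [N]. *)
Definition recip (C : numClosedFieldType) N (p : {poly C}) : {poly C} :=
  \poly_(i < N.+1) (p`_(N - i))^*.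

Lemma recipE (C : numClosedFieldType) N (p : {poly C}) :
  recip N p = \sum_(v < N.+1) (p`_v)^* *: 'X^(N - v).
Proof.
rewrite /recip poly_def (reindex_inj rev_ord_inj) /=; apply: eq_bigr => i _.
by rewrite subSS subKn // -ltnS.
Qed.

(** Reflecting a factor z - r in the unit circle gives 1 - conj r z. *)
Lemma recip_prod (C : numClosedFieldType) (rs : seq C) :
  recip (size rs) (\prod_(r <- rs) ('X - r%:P))
  = \prod_(r <- rs) (1 - r^* *: 'X).
Proof.
elim: rs => [|r rs IH].
  rewrite !big_nil recipE big_ord1 coef1 /= conjC1 scale1r subnn expr0 //.
rewrite !big_cons -IH mulrC [RHS]mulrC.
set p := \prod_(i <- rs) _.
have sp : size p = (size rs).+1 by exact: size_prod_XsubC.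
apply/polyP => i; rewrite !mulrBr mulr1 -scalerAr coefB coefZ coefMX !coef_poly.
rewrite coefB coefMC coefMX /= rmorphB rmorphM /=.
case: i => [|i] /=.
  rewrite subn0 mulr0 [p`_(size rs).+1]nth_default ?sp // conjC0.
  by rewrite mul0r subn0.
rewrite !ltnS subSS; case: (ltngtP i (size rs)) => hi.
- rewrite (_ : size rs - i == 0 = false)%N; last by apply/negbTE; lia.
  by rewrite (_ : (size rs - i).-1 = size rs - i.+1)%N 1?[_ * r^*]mulrC //; lia.
- by rewrite mulr0 subr0.
- by rewrite hi subnn /= conjC0 mulrC.
Qed.

Lemma mul_recip_herm (C : numClosedFieldType) n (p : {poly C}) :
  (size p <= n.+1)%N -> p * recip n p = herm n (fun u v => p`_u * (p`_v)^*).
Proof.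
move=> sp; rewrite recipE.
rewrite -{1}[p]coefK poly_def (big_ord_widen n.+1 (fun i => p`_i *: 'X^i) sp).
rewrite (_ : \sum_(i < _ | _) _ = \sum_(i < n.+1) p`_i *: 'X^i); last first.
  rewrite big_mkcond; apply: eq_bigr => i _; case: ltnP => // hi.
  by rewrite nth_default // scale0r.
rewrite big_distrlr; apply: eq_bigr => u _; apply: eq_bigr => v _ /=.
rewrite -scalerAl -scalerAr scalerA -exprD; congr (_ *: 'X^_).
by have := ltn_ord v; lia.
Qed.

(** * The polynomial W_0 *)

Definition zpoly (C : numClosedFieldType) n (z : 'I_n -> C) : {poly C} :=
  \prod_(r <- [seq z j | j <- enum 'I_n]) ('X - r%:P).

Definition crits (C : numClosedFieldType) n (z : 'I_n -> C) : seq C :=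
  [seq z j | j <- enum 'I_n] ++ [seq ((z j)^*)^-1 | j <- enum 'I_n].

Lemma W0_crits (C : numClosedFieldType) n (z : 'I_n -> C) :
  W0 z = \prod_(r <- crits z) ('X - r%:P).
Proof.
by rewrite /W0 big_split /= /crits big_cat !big_map -!big_enum.
Qed.

Lemma size_W0 (C : numClosedFieldType) n (z : 'I_n -> C) :
  size (W0 z) = (2 * n).+1.
Proof.
rewrite W0_crits size_prod_XsubC size_cat (size_map z).
by rewrite (size_map (fun j => ((z j)^*)^-1)) size_enum_ord mul2n addnn.
Qed.

(** The factor of the reflected point, z - 1 / conj z_j, is a constant times
    1 - conj z_j z. *)
Lemma W0E (C : numClosedFieldType) n (z : 'I_n -> C) :
  (forall j, z j != 0) ->
  exists2 K, K != 0 & W0 z = K *: (zpoly z * recip n (zpoly z)).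
Proof.
move=> z0; exists (\prod_j (- ((z j)^*)^-1)).
  by apply/prodf_neq0 => j _; rewrite oppr_eq0 invr_eq0 conjC_eq0.
have -> : recip n (zpoly z) = \prod_(j < n) (1 - (z j)^* *: 'X).
  have := recip_prod [seq z j | j <- enum 'I_n].
  by rewrite size_map size_enum_ord /zpoly => ->; rewrite big_map -big_enum.
rewrite /W0 big_split /= /zpoly big_map scalerAr; congr (_ * _).
  by rewrite -big_enum.
rewrite -mul_polyC rmorph_prod -big_split /=; apply: eq_bigr => j _.
rewrite mulrBr mulr1 mul_polyC scalerA mulNr mulVf ?conjC_eq0 //.
by rewrite scaleN1r opprK polyCN addrC.
Qed.

Lemma zpoly_herm (C : numClosedFieldType) n (z : 'I_n -> C) :
  zpoly z * recip n (zpoly z)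
  = herm n (fun u v => (zpoly z)`_u * ((zpoly z)`_v)^*).
Proof.
by apply: mul_recip_herm; rewrite size_prod_XsubC size_map size_enum_ord.
Qed.

(** The middle coefficient is the sum of the squared moduli of the
    coefficients of the monic polynomial with roots z_j. *)
Lemma zpoly_mid_gt0 (C : numClosedFieldType) n (z : 'I_n -> C) :
  0 < (zpoly z * recip n (zpoly z))`_n.
Proof.
rewrite zpoly_herm coef_herm_low // subnn.
rewrite big_ord_recr /= add0n.
have -> : (zpoly z)`_n = 1.
  have /monicP := monic_prod_XsubC [seq z j | j <- enum 'I_n] xpredT id.
  by rewrite /lead_coef size_prod_XsubC size_map size_enum_ord.
rewrite conjC1 mulr1 ltr_wpDl ?ltr01 //; apply: sumr_ge0 => u _.
by rewrite add0n mul_conjC_ge0.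
Qed.

Lemma W0_mid_neq0 (C : numClosedFieldType) n (z : 'I_n -> C) :
  (forall j, z j != 0) -> (W0 z)`_n != 0.
Proof.
move=> z0; have [K K0 ->] := W0E z0.
by rewrite coefZ mulf_neq0 // gt_eqF // zpoly_mid_gt0.
Qed.

Lemma ccoef_conj (C : numClosedFieldType) n (z : 'I_n -> C) d :
  (forall j, z j != 0) -> (d <= 2 * n)%N ->
  (ccoef z d)^* = ccoef z (2 * n - d).
Proof.
move=> z0 hd; rewrite /ccoef; have [K K0 ->] := W0E z0; rewrite !coefZ.
have g0 := zpoly_mid_gt0 z; set g := _ * recip _ _ in g0 *.
have [_ gc] : self_inversive n g.
  rewrite /g zpoly_herm; apply: herm_self_inversive => u v.
  by rewrite rmorphM /= conjCK mulrC.
have E x : n.+1%:R * (K * x) / (K * g`_n) = n.+1%:R * (x / g`_n).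
  by field; rewrite gt_eqF.
rewrite !E rmorphM rmorph_nat /= fmorph_div /= !gc //; last by lia.
by rewrite (_ : 2 * n - n = n)%N //; lia.
Qed.

Lemma ccoef_mid (C : numClosedFieldType) n (z : 'I_n -> C) :
  (forall j, z j != 0) -> ccoef z n = n.+1%:R.
Proof. by move=> z0; rewrite /ccoef mulfK ?W0_mid_neq0. Qed.

(** The reflections lie outside the disk, so they meet none of the z_j. *)
Lemma uniq_crits (C : numClosedFieldType) n (z : 'I_n -> C) :
  injective z -> (forall j, z j != 0) -> (forall j, `|z j| < 1) ->
  uniq (crits z).
Proof.
move=> z_inj z0 zd; have inv_inj : injective (fun j => ((z j)^*)^-1).
  by move=> i j /invr_inj /(can_inj conjCK) /z_inj.
rewrite cat_uniq (map_inj_uniq z_inj) (map_inj_uniq inv_inj) enum_uniq andbT.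
apply/hasPn => x /mapP[j _ ->]; apply/mapP => -[i _ hij].
have := zd i; rewrite -hij normfV norm_conjC invf_lt1 ?normr_gt0 //.
by move=> /lt_trans /(_ (zd j)); rewrite ltxx.
Qed.

(** Prescribing the lower half of the coefficients of a self-inversive polynomial
    prescribes the upper half; realness of [tau] makes the latter agree with the
    upper half of tau times the c_d. *)
Lemma self_inversive_low (C : numClosedFieldType) n (z : 'I_n -> C)
    (p : {poly C}) tau :
  (forall j, z j != 0) -> self_inversive n p -> tau \is Num.real ->
  (forall d, (d <= n)%N -> p`_d = tau * ccoef z d) ->
  p = (tau * n.+1%:R / (W0 z)`_n) *: W0 z.
Proof.
move=> z0 [sp hp] taur htau; have w0 := W0_mid_neq0 z0.
have htau2 d : (d <= 2 * n)%N -> p`_d = tau * ccoef z d.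
  move=> hd; case: (leqP d n) => hdn; first exact: htau.
  have hd' : (2 * n - d <= n)%N by lia.
  rewrite -[d](subKn hd) -hp ?leq_subr // htau // rmorphM /= ccoef_conj //.
    by rewrite (CrealP taur).
  by rewrite leq_subr.
apply/polyP => d; rewrite coefZ; case: (leqP d (2 * n)) => hd.
  by rewrite htau2 // /ccoef; field.
have hd0 : (size (W0 z) <= d)%N by rewrite size_W0.
by rewrite (nth_default 0 (leq_trans sp hd)) (nth_default 0 hd0) mulr0.
Qed.

(** A self-inversive polynomial vanishing at the z_j also vanishes at their
    reflections, and these are already 2n points; hence it is a multiple of W_0.
    Its middle coefficient is real, and so is that of the normalization of W_0,
    so the factor is real. *)
Lemma self_inversive_multiple (C : numClosedFieldType) n (z : 'I_n -> C)
    (p : {poly C}) :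
  injective z -> (forall j, z j != 0) -> (forall j, `|z j| < 1) ->
  self_inversive n p ->
  (forall k, root p (z k)) <->
  (exists2 tau, tau \is Num.real
                & forall d, (d <= n)%N -> p`_d = tau * ccoef z d).
Proof.
move=> z_inj z0 zd sip; have w0 := W0_mid_neq0 z0.
split=> [hroot|[tau taur htau] k]; last first.
  rewrite (self_inversive_low z0 sip taur htau).
  rewrite rootE hornerZ W0_crits (rootP _) ?mulr0 // root_prod_XsubC.
  by rewrite mem_cat map_f // mem_enum.
have [sp hp] := sip; have n0 : n.+1%:R != 0 :> C by rewrite pnatr_eq0.
have hall : all (root p) (crits z).
  rewrite all_cat; apply/andP; split; apply/allP => x /mapP[j _ ->] //.
  exact: self_inversive_root sip (z0 j) (hroot j).
have /uniq_roots_prod_XsubC : uniq_roots (crits z).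
  by rewrite uniq_rootsE uniq_crits.
move=> /(_ _ hall)[q]; rewrite -W0_crits => pE.
have W0n0 : W0 z != 0 by rewrite -size_poly_eq0 size_W0.
have [c qc] : exists c, q = c%:P.
  case: (eqVneq q 0) => [->|q0]; first by exists 0.
  have := sp; rewrite pE size_mul // size_W0 addnS /=.
  by rewrite -[(2 * n).+1]add1n leq_add2r => /size1_polyC; exists q`_0.
exists (p`_n / n.+1%:R).
  rewrite rpredM ?rpredV ?realn //; apply/CrealP; rewrite hp; last by lia.
  by rewrite (_ : 2 * n - n = n)%N //; lia.
move=> d _; rewrite pE qc mul_polyC !coefZ /ccoef.
by move: (n.+1%:R) n0 => N N0; field; rewrite w0 N0.
Qed.

(** * The numerator of the derivative *)

(** Coefficient of degree [u.+1] of the numerator of B. *)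
Definition num_coef (C : numClosedFieldType) n (a : 'cV[C]_n) (u : nat) : C :=
  if u == n then 1 else ext a u.+1.

Lemma BnumE (C : numClosedFieldType) n (a : 'cV[C]_n) :
  Bnum a = \sum_(u < n.+1) num_coef a u *: 'X^(u.+1).
Proof.
rewrite /Bnum big_add1 /= big_mkord big_ord_recr /= /num_coef eqxx scale1r.
by congr (_ + _); apply: eq_bigr => u _; rewrite ltn_eqF.
Qed.

Lemma BdenE (C : numClosedFieldType) n (a : 'cV[C]_n) :
  Bden a = \sum_(v < n.+1) (num_coef a v)^* *: 'X^(n - v).
Proof.
rewrite /Bden big_add1 /= big_mkord big_ord_recr /= /num_coef eqxx conjC1.
rewrite subnn expr0 scale1r addrC; congr (_ + _).
by apply: eq_bigr => u _; rewrite ltn_eqF // subSS.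
Qed.

Lemma coef_Bnum (C : numClosedFieldType) n (a : 'cV[C]_n) i :
  (Bnum a)`_i = if (0 < i <= n.+1)%N then num_coef a i.-1 else 0.
Proof.
rewrite BnumE coef_sum; case: ifPn => hi.
  have hi' : (i.-1 < n.+1)%N by lia.
  rewrite (bigD1 (Ordinal hi')) //= coefZ coefXn prednK ?eqxx ?mulr1; last by lia.
  rewrite big1 ?addr0 // => u hu; rewrite coefZ coefXn.
  case: eqP => ei; last by rewrite mulr0.
  by case/negP: hu; apply/eqP/val_inj; rewrite /= ei.
rewrite big1 // => u _; rewrite coefZ coefXn; case: eqP => ei; last by rewrite mulr0.
by have := ltn_ord u; lia.
Qed.

Lemma size_Bnum (C : numClosedFieldType) n (a : 'cV[C]_n) : size (Bnum a) = n.+2.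
Proof.
apply/eqP; rewrite eqn_leq; apply/andP; split.
  by apply/leq_sizeP => j hj; rewrite coef_Bnum ifF //; apply/negbTE; lia.
apply: contraT; rewrite -leqNgt => hs.
have := coef_Bnum a n.+1; rewrite nth_default // leqnn /= /num_coef eqxx.
by move/esym/eqP; rewrite oner_eq0.
Qed.

Lemma monic_Bnum (C : numClosedFieldType) n (a : 'cV[C]_n) : Bnum a \is monic.
Proof.
by rewrite monicE /lead_coef size_Bnum coef_Bnum leqnn /= /num_coef eqxx.
Qed.

Lemma Bden_recip (C : numClosedFieldType) n (a : 'cV[C]_n) :
  Bden a = recip n.+1 (Bnum a).
Proof.
rewrite recipE BdenE [RHS]big_ord_recl coef_Bnum /= conjC0 scale0r add0r.
by apply: eq_bigr => v _; rewrite coef_Bnum /= ltn_ord subSS.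
Qed.

Definition wronskian (C : numClosedFieldType) n (a : 'cV[C]_n) : {poly C} :=
  (Bnum a)^`() * Bden a - Bnum a * (Bden a)^`().

(** The terms z^(u+1) of the numerator and z^(n-v) of the denominator
    contribute u + 1 - (n - v) times z^(u+n-v). *)
Lemma wronskian_herm (C : numClosedFieldType) n (a : 'cV[C]_n) :
  wronskian a = herm n (fun u v => ((u + v).+1%:R - n%:R)
                                   * (num_coef a u * (num_coef a v)^*)).
Proof.
rewrite /wronskian BnumE BdenE !raddf_sum !big_distrlr -sumrB.
apply: eq_bigr => u _; rewrite -sumrB; apply: eq_bigr => v _ /=.
have hv : (v <= n)%N by rewrite -ltnS.
rewrite !derivZ !derivXn -!scalerAl -!scalerAr !scalerA -scalerBr /=.
rewrite [X in _ = X *: _]mulrC -[RHS]scalerA; congr (_ *: _).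
rewrite mulrnAl mulrnAr -!exprD addnBA //.
have -> : 'X^(u.+1 + (n - v).-1) *+ (n - v) = 'X^(u + n - v) *+ (n - v) :> {poly C}.
  by case: (posnP (n - v)) => [->|hv0]; rewrite ?mulr0n //; congr ('X^_ *+ _); lia.
rewrite -!scaler_nat -scalerBl; congr (_ *: _).
by rewrite natrB // -!natr1 natrD; ring.
Qed.

Lemma wronskian_self_inversive (C : numClosedFieldType) n (a : 'cV[C]_n) :
  self_inversive n (wronskian a).
Proof.
rewrite wronskian_herm; apply: herm_self_inversive => u v.
rewrite !rmorphM rmorphB /= !rmorph_nat conjCK addnC; congr (_ * _).
by rewrite mulrC.
Qed.

Definition wmonom (C : numClosedFieldType) n (a : 'cV[C]_n) d : C :=
  \sum_(e <- xblock n d) wt C n e * monom a e.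

(** Restoring the omitted index is harmless for summands that vanish there,
    as those carrying its weight do. *)
Lemma big_idx (R : nmodType) d (F : nat -> R) :
  (forall i, (2 * i)%N = d.+1 -> F i = 0) ->
  \sum_(i <- idx d d.+1) F i = \sum_(u < d) F u.+1.
Proof.
move=> hF; rewrite big_filter big_mkcond.
rewrite (_ : iota 1 d = index_iota 1 d.+1); last by rewrite /index_iota subn1.
rewrite big_add1 big_mkord.
by apply: eq_bigr => u _; case: ifPn => // /negPn/eqP/hF ->.
Qed.

Lemma wt_mid (C : numClosedFieldType) n d i : (d <= n)%N ->
  (2 * i)%N = d.+1 -> wt C n (i, (n - d + i)%N) = 0.
Proof.
by move=> hd hi; rewrite wt_quad ?hi; [rewrite -natr1; ring | lia | ].
Qed.

Lemma wtC (C : numClosedFieldType) n u v : wt C n (u, v) = wt C n (v, u).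
Proof. by rewrite /wt /= addnC. Qed.

(** The block x^n misses the pair a_{n+1} conj a_{n+1} = 1 of weight n + 1,
    which is why the extra term appears in degree n only. *)
Lemma coef_wronskian (C : numClosedFieldType) n (a : 'cV[C]_n) d :
  (2 <= n)%N -> (d <= n)%N ->
  (wronskian a)`_d = wmonom a d + n.+1%:R *+ (d == n).
Proof.
move=> hn hd; rewrite wronskian_herm coef_herm_low // big_ord_recr /= subnK //.
have -> : \sum_(u < d) ((u + (n - d + u)).+1%:R - n%:R)
      * (num_coef a u * (num_coef a (n - d + u))^* )
    = \sum_(i <- idx d d.+1)
        wt C n (i, (n - d + i)%N) * monom a (i, (n - d + i)%N).
  rewrite big_idx => [|i hi]; last by rewrite wt_mid ?mul0r.
  apply: eq_bigr => u _; have hu := ltn_ord u.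
  rewrite /monom /num_coef /= addnS !ltn_eqF; [|lia..].
  congr (_ * _); rewrite /wt /= addnS addSn.
  by rewrite -[n.+1%:R]natr1 -[_.+2%:R]natr1; ring.
rewrite {2}/num_coef eqxx conjC1 mulr1 -addSn natrD addrK /wmonom.
case: ltngtP hd => // [hdn|->] _.
  rewrite addr0 xblock_lt // big_cons wt_lin addrC big_map; congr (_ * _ + _).
  by rewrite /monom /num_coef ltn_eqF //= /ext /= conjC1 mulr1.
rewrite xblock_diag // big_map /num_coef eqxx mulr1; congr (_ + _).
by apply: eq_bigr => i _; rewrite subnn add0n.
Qed.

Lemma monom_conj (C : numClosedFieldType) n (a : 'cV[C]_n) u v :
  (monom a (u, v))^* = monom a (v, u).
Proof. by rewrite /monom rmorphM /= conjCK mulrC. Qed.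

Lemma wmonom_conj (C : numClosedFieldType) n (a : 'cV[C]_n) d :
  (2 <= n)%N -> (d < n)%N -> wmonom a (2 * n - d) = (wmonom a d)^*.
Proof.
move=> hn hd; have conj_wt e : (wt C n e)^* = wt C n e.
  by rewrite /wt rmorphB /= !rmorph_nat.
rewrite /wmonom xblock_gt // xblock_lt // -cats1 big_cat big_seq1 big_cons.
rewrite rmorphD addrC rmorphM /= conj_wt monom_conj -wtC; congr (_ + _).
rewrite !big_map (big_idx (F := fun i => wt C n ((n.+1 - i)%N, (d.+1 - i)%N)
                            * monom a ((n.+1 - i)%N, (d.+1 - i)%N))); last first.
  move=> i hi; rewrite wtC (_ : d.+1 - i = i)%N; last by lia.
  by rewrite (_ : n.+1 - i = n - d + i)%N ?wt_mid ?mul0r //; lia.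
rewrite (big_idx (F := fun i => wt C n (i, (n - d + i)%N)
                            * monom a (i, (n - d + i)%N))); last first.
  by move=> i hi; rewrite wt_mid ?mul0r // ltnW.
rewrite rmorph_sum (reindex_inj rev_ord_inj); apply: eq_bigr => u _ /=.
have hu := ltn_ord u; rewrite rmorphM /= conj_wt monom_conj wtC.
rewrite (_ : d.+1 - (d - u.+1).+1 = u.+1)%N; last by lia.
by rewrite (_ : n.+1 - (d - u.+1).+1 = n - d + u.+1)%N; last by lia.
Qed.

Lemma coef_wronskian_all (C : numClosedFieldType) n (a : 'cV[C]_n) d :
  (2 <= n)%N -> (d <= 2 * n)%N ->
  (wronskian a)`_d = wmonom a d + n.+1%:R *+ (d == n).
Proof.
move=> hn hd; case: (leqP d n) => hdn; first exact: coef_wronskian.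
have [e he ->] : exists2 e, (e < n)%N & d = (2 * n - e)%N.
  by exists (2 * n - d)%N; lia.
have [_ hc] := wronskian_self_inversive a.
rewrite -hc; last by lia.
rewrite (coef_wronskian a hn (ltnW he)) (wmonom_conj a hn he) (ltn_eqF he).
by rewrite addr0 (_ : (2 * n - e == n)%N = false) ?addr0 //; apply/negbTE; lia.
Qed.

(** The k-th equation of the quadratic system is the vanishing of the numerator
    of B' at z_k, with the term (n + 1) z_k^n moved to the right. *)
Lemma quad_systemP (C : numClosedFieldType) n (z : 'I_n -> C) (a : 'cV[C]_n) :
  (2 <= n)%N -> quad_system z a <-> (forall k, root (wronskian a) (z k)).
Proof.
move=> hn.
have rowE k : (Ahat z *m xhat a + Atail z *m xtail a) k 0
    = \sum_(d < (2 * n).+1) wmonom a d * z k ^+ d.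
  transitivity (\sum_(i < dimp n + dimq n) Amx z (lshift n k) i * xvec a i 0).
    rewrite big_split_ord /= !mxE.
    by congr (_ + _); apply: eq_bigr => i _; rewrite !mxE.
  transitivity (\sum_(q <- entries n)
      (z k ^+ q.1 * wt C n q.2) * monom a q.2).
    rewrite (big_nth (0, (0, 0))%N) size_entries // big_mkord.
    apply: eq_bigr => i _; rewrite /Amx /xvec /colv !mxE.
    rewrite (concat_entries n (fun _ => monom a)).
    have -> : concat n (fun d => [seq zpt z (lshift n k) ^+ d * w
                                     | w <- wblock C n d])
       = [seq z k ^+ q.1 * wt C n q.2 | q <- entries n].
      rewrite -(concat_entries n (fun d e => z k ^+ d * wt C n e)).
      congr flatten; apply/eq_in_map => d; rewrite mem_iota add0n ltnS => hd.
      rewrite wblockE //.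
      rewrite -map_comp; apply: eq_map => e /=.
      by rewrite /zpt -[lshift n k]/(unsplit (inl k)) unsplitK.
    by rewrite !(nth_map (0, (0, 0))%N) ?size_entries.
  rewrite (big_entries n (fun d e => z k ^+ d * wt C n e * monom a e)).
  apply: eq_bigr => d _; rewrite /wmonom mulr_suml; apply: eq_bigr => e _.
  by rewrite -mulrA mulrC.
have hornE x : (wronskian a).[x]
    = \sum_(d < (2 * n).+1) wmonom a d * x ^+ d + n.+1%:R * x ^+ n.
  have [sW _] := wronskian_self_inversive a.
  rewrite (horner_coef_wide _ sW).
  have hn2 : (n < (2 * n).+1)%N by lia.
  rewrite (bigD1 (Ordinal hn2)) //= [in RHS](bigD1 (Ordinal hn2)) //=.
  rewrite coef_wronskian_all -1?ltnS // eqxx mulrDl -!addrA; congr (_ + _).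
  rewrite addrC; congr (_ + _).
  apply: eq_bigr => d hdn; rewrite coef_wronskian_all // -1?ltnS //.
  by rewrite (_ : (d == n :> nat) = false) ?addr0 //; apply: negbTE hdn.
split=> [hq k|hr].
  by rewrite rootE hornE -rowE hq mxE mulNr addNr.
apply/matrixP => k j; rewrite (ord1 j) rowE mxE mulNr.
by apply/eqP; rewrite -addr_eq0 -hornE -rootE.
Qed.

(** * Numerator and denominator have no common zero *)

(** The lowest nonvanishing coefficient of the numerator of B also appears,
    up to a positive integer, in the numerator of B'. *)
Lemma wronskian_neq0 (C : numClosedFieldType) n (a : 'cV[C]_n) :
  wronskian a != 0.
Proof.
apply/eqP => W0; suff h d : (d <= n)%N -> num_coef a d = 0.
  by have := h n (leqnn n); rewrite /num_coef eqxx => /eqP; rewrite oner_eq0.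
elim/ltn_ind: d => d IH hd.
have := coef_herm_low (fun u v => ((u + v).+1%:R - n%:R)
                                   * (num_coef a u * (num_coef a v)^*)) hd.
rewrite -wronskian_herm W0 coef0 big_ord_recr /= subnK // big1 => [|u _]; last first.
  by rewrite IH ?mul0r ?mulr0 //; have := ltn_ord u; lia.
rewrite add0r -addSn natrD addrK {2}/num_coef eqxx conjC1 mulr1.
by move/esym/eqP; rewrite mulf_eq0 pnatr_eq0 => /eqP.
Qed.

(** A common zero r makes (z - r)^2 divide the numerator of B'.  But that is a
    nonzero multiple of W_0, which has 2n distinct zeros. *)
Lemma coprime_Bnum_Bden (C : numClosedFieldType) n (z : 'I_n -> C) 
    (a : 'cV[C]_n) :
  (2 <= n)%N ->
  injective z -> (forall j, z j != 0) -> (forall j, `|z j| < 1) ->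
  (forall k, root (wronskian a) (z k)) -> coprimep (Bnum a) (Bden a).
Proof.
move=> hn z_inj z0 zd hroot.
apply/Pdiv.ClosedField.coprimepP => r /factor_theorem[p1 hp1]; apply/negP.
move=> /factor_theorem[q1 hq1].
have hW : wronskian a = ('X - r%:P) ^+ 2 * (p1^`() * q1 - p1 * q1^`()).
  by rewrite /wronskian hp1 hq1 !derivM derivXsubC; ring.
have sip := wronskian_self_inversive a.
have [tau taur htau] := (self_inversive_multiple z_inj z0 zd sip).1 hroot.
have [c WE] : exists c, wronskian a = c *: W0 z.
  by eexists; exact: self_inversive_low z0 sip taur htau.
have c0 : c != 0.
  by apply: contraNneq (wronskian_neq0 a) => c0; rewrite WE c0 scale0r.
have : separable_poly (W0 z) by rewrite W0_crits separable_prod_XsubC uniq_crits.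
have -> : W0 z = ('X - r%:P) ^+ 2 * (c^-1 *: (p1^`() * q1 - p1 * q1^`())).
  by rewrite -scalerAr -hW WE scalerA mulVf // scale1r.
move: (c^-1 *: _) => s; rewrite separable_poly.unlock => hsep.
have hr : ('X - r%:P).[r] = 0 by rewrite hornerXsubC subrr.
move: ('X - r%:P) hr (derivXsubC r) hsep => L hr dL hsep.
have := @coprimep_root _ _ _ r hsep.
rewrite derivM expr2 derivM dL mul1r mulr1 rootE !(hornerM, hornerD) hr.
by rewrite !(mul0r, addr0) eqxx => /(_ isT).
Qed.

(** * Blaschke products and Blaschke forms *)

(** The denominator is the reflected numerator, so its zeros are the points
    1 / conj r for the zeros r <> 0 of the numerator.  If every r lies in the
    disk, B is a Blaschke product; if some |r| > 1, then 1 / conj r is a pole in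
    the disk; and |r| = 1 is excluded, since r would be a common zero. *)
Lemma Bfun_blaschke (C : numClosedFieldType) n (a : 'cV[C]_n) :
  coprimep (Bnum a) (Bden a) ->
  blaschke_product n.+1 (Bfun a) \/ blaschke_form n.+1 (Bfun a).
Proof.
move=> cop; have [rs hrs] := closed_field_poly_normal (Bnum a).
rewrite (monicP (monic_Bnum a)) scale1r in hrs.
have srs : size rs = n.+1.
  by have := size_Bnum a; rewrite hrs size_prod_XsubC => -[].
have hden : Bden a = \prod_(r <- rs) (1 - r^* *: 'X).
  by rewrite Bden_recip hrs -srs recip_prod.
have [/allP hdisk|] := boolP (all (fun r => `|r| < 1) rs).
  left; exists 1, (fun j : 'I_n.+1 => rs`_j); split.
  - by rewrite normr1.
  - by move=> j; apply: hdisk; rewrite mem_nth // srs.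
  - rewrite /Bfun hrs hden rmorph1 mul1r !rmorph_prod /= -prodf_div.
    by rewrite (big_nth 0) srs big_mkord.
case/allPn => r hr hr1; right.
have {hr1} hr1 : 1 <= `|r| by rewrite real_leNgt ?realn // ?normr_real // real1.
have r0 : r != 0 by rewrite -normr_gt0 (lt_le_trans ltr01).
have rden : root (Bden a) (r^*)^-1.
  rewrite hden (big_rem r hr) /= rootM; apply/orP; left.
  by rewrite rootE hornerD hornerN hornerZ hornerX hornerC mulfV ?conjC_eq0 // subrr.
exists (fun i => (Bnum a)`_i).
have numE : \sum_(i < n.+2) (Bnum a)`_i *: 'X^i = Bnum a.
  by rewrite -[RHS]coefK size_Bnum poly_def.
have denE : \sum_(i < n.+2) ((Bnum a)`_(rev_ord i))^* *: 'X^i = Bden a.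
  rewrite Bden_recip recipE (reindex_inj rev_ord_inj) /=; apply: eq_bigr => i _.
  by rewrite subSS subKn // -ltnS.
rewrite /= numE denE; split=> //; exists (r^*)^-1 => //.
rewrite normfV norm_conjC invf_lt1 ?normr_gt0 // lt_neqAle hr1 andbT.
apply/eqP => nr1; have rr : (r^*)^-1 = r.
  by rewrite invC_norm conjCK norm_conjC -nr1 expr1n invr1 mul1r.
have := coprimep_root cop (_ : root (Bnum a) r); rewrite -{2}rr.
rewrite hrs root_prod_XsubC hr => /(_ isT).
by move: rden; rewrite rootE => ->.
Qed.

(** * Equivalence of the two systems *)

(** The parameter of the sparse system is tb = tau - 1, where tau is the factor
    with which the normalized W_0 occurs in the numerator of B'. *)
Lemma quad_sparse (C : numClosedFieldType) n (z : 'I_n -> C) (a : 'cV[C]_n) :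
  (2 <= n)%N ->
  injective z -> (forall j, z j != 0) -> (forall j, `|z j| < 1) ->
  quad_system z a <->
  (exists t tb, tb \is Num.real /\ sparse_system z (xhat a) t tb).
Proof.
move=> hn z_inj z0 zd.
have wdotE d : (d <= n)%N -> wdot d (xhat a) = wmonom a d.
  by move=> hd; rewrite xhatE wdot_hat.
apply: iff_trans (quad_systemP z a hn) _.
apply: iff_trans
  (self_inversive_multiple z_inj z0 zd (wronskian_self_inversive a)) _.
split=> [[tau taur htau]|[t [tb [tbr [hlin _]]]]].
  have [|t ht] := (sparse_linearP z (xhat a) (tau - 1) hn).2.
    move=> d hd; rewrite wdotE //; have := htau d hd.
    rewrite coef_wronskian // [1 + _]addrC subrK; case: ltngtP hd => // [hdn|->] _.
      by rewrite addr0.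
    by rewrite ccoef_mid // mulr1n => /(canRL (addrK _)) ->; ring.
  exists t, (tau - 1); split; first by rewrite rpredB ?rpred1.
  by split=> //; exact: quadratic_eqs_xhat.
exists (1 + tb); first by rewrite rpredD ?rpred1.
have hw := (sparse_linearP z (xhat a) tb hn).1 (ex_intro _ t hlin).
move=> d hd; rewrite coef_wronskian // -wdotE // hw //.
case: ltngtP hd => // [hdn|->] _; first by rewrite addr0.
by rewrite ccoef_mid // mulr1n; ring.
Qed.

Local Open Scope complex_scope.

Theorem theorem2p1 (R : realType) (n : nat) (z : 'I_n -> R[i])
    (hn : (2 <= n)%N) (z_inj : injective z) (z_neq0 : forall j, z j != 0)
    (z_disk : forall j, `|z j| < 1) :
  (forall a : 'cV[R[i]]_n,
     quad_system z a <->
     exists (t : 'cV[R[i]]_(dimm n - 1)) (tbeta : R),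
       sparse_system z (xhat a) t tbeta%:C)
  /\
  (forall (x : 'cV[R[i]]_(dimp n)) (t : 'cV[R[i]]_(dimm n - 1)) (tbeta : R),
     sparse_system z x t tbeta%:C ->
     (exists a : 'cV[R[i]]_n, x = xhat a)
     /\ (forall a : 'cV[R[i]]_n, x = xhat a ->
           (forall i : nat, (1 <= i <= n)%N -> ext a i = ext x (Jidx i))
           /\ (blaschke_product n.+1 (Bfun a) \/ blaschke_form n.+1 (Bfun a)))).
Proof.
have realE (tb : R) : tb%:C \is Num.real by apply/complex_realP; exists tb.
split=> [a|x t tb hx].
  apply: iff_trans (quad_sparse a hn z_inj z_neq0 z_disk) _.
  split=> [[t [tb [/complex_realP[s ->] h]]]|[t [tb h]]]; first by exists t, s.
  by exists t, tb%:C.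
split=> [|a xa]; first by case: hx => _ /(quadratic_eqsP hn).
split=> [i hi|]; first by rewrite xa ext_xhat_Jidx.
apply/Bfun_blaschke/(coprime_Bnum_Bden hn z_inj z_neq0 z_disk).
apply/(quad_systemP z a hn)/(quad_sparse a hn z_inj z_neq0 z_disk).
by exists t, tb%:C; rewrite -xa.
Qed.
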